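(* Let $r\ge 1$, let $\mathcal{U}$ be a finite index set, and let $\{Y(u,n):u\in\mathcal{U}\}$, $n\in\mathbb{N}$, be a family of independent (non-Hermitian) Gaussian random matrices with independent block-identically distributed complex entries, each $Y(u,n)$ having blocks $(S_{p,q}(u,n))_{1\le p,q\le r}$ and symmetric block covariance matrix $V(u)=(v_{p,q}(u))$. Let $D=\mathrm{diag}(d_1,\dots,d_r)$ be the dimension matrix and let $\zeta_{p,q}(u)$ be the matricial circular operators associated with the matrices $B(u)=DV(u)$, i.e. $b_{p,q}(u)=d_p v_{p,q}(u)$. Then $$\lim_{n\to\infty}S_{p,q}(u,n)=\zeta_{p,q}(u)\qquad(1\le p,q\le r,\ u\in\mathcal{U})$$ in the sense of mixed $*$-moments under partial traces; that is, for every $k\in\{1,\dots,r\}$, $m\in\mathbb{N}$, $p_j,q_j\in\{1,\dots,r\}$, $u_j\in\mathcal{U}$, $\epsilon_j\in\{1,*\}$, $$\lim_{n\to\infty}\tau_k(n)\big(S_{p_1,q_1}^{\epsilon_1}(u_1,n)\cdots S_{p_m,q_m}^{\epsilon_m}(u_m,n)\big)=\Psi_k\big(\zeta_{p_1,q_1}^{\epsilon_1}(u_1)\cdots\zeta_{p_m,q_m}^{\epsilon_m}(u_m)\big).$$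
   Context: Blocks and partial traces. For each $n\ge r$ let $\{1,\dots,n\}=N_1\cup\dots\cup N_r$ be a partition into disjoint non-empty intervals (depending on $n$), $n_q=|N_q|$, and assume $n_q/n\to d_q\ge 0$ as $n\to\infty$ for each $q$. Some $d_q$ may be zero. The partial traces are $\tau_q(n)=\frac1{n_q}\,\mathbb{E}\otimes \mathrm{tr}_q(n)$, where $\mathrm{tr}_q(n)(X)=\sum_{i\in N_q}X_{i,i}$ and $\mathbb{E}$ is the classical expectation. The block $S_{p,q}(u,n)$ is the $n\times n$ matrix $D_pY(u,n)D_q$, where $D_q$ is the diagonal $n\times n$ matrix with $(D_q)_{k,k}=1$ if $k\in N_q$ and all other entries $0$. Random matrices. $Y(u,n)=(Y_{i,j}(u,n))_{1\le i,j\le n}$, where for each $n$ all the entries $Y_{i,j}(u,n)$ ($1\le i,j\le n$, $u\in\mathcal{U}$) are independent, each entry is a mean-zero (circularly symmetric) complex Gaussian random variable, and $\mathbb{E}|Y_{i,j}(u,n)|^2=v_{p,q}(u)/n$ whenever $(i,j)\in N_p\times N_q$. The matrix $V(u)=(v_{p,q}(u))_{1\le p,q\le r}$ of non-negative numbers is the block covariance matrix. Operators. Let $\mathcal{V}=\{u',u'':u\in\mathcal{U}\}$ consist of two distinct copies $u',u''$ of each $u$. Let $\mathcal{M}$ be the Hilbert space with orthonormal basis consisting of vectors $\Omega_1,\dots,\Omega_r$ and of all $e_{p_1,p_2}(v_1)\otimes e_{p_2,p_3}(v_2)\otimes\dots\otimes e_{p_m,q}(v_m)$ with $m\ge1$,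 $p_1,\dots,p_m,q\in\{1,\dots,r\}$, $v_1,\dots,v_m\in\mathcal{V}$. For a matrix $B(u)=(b_{p,q}(u))$ of non-negative numbers put $b_{p,q}(u')=b_{p,q}(u'')=b_{p,q}(u)$. The matricially free creation operator $\wp_{p,q}(v)$ is the bounded operator on $\mathcal{M}$ with $\wp_{p,q}(v)\Omega_q=\sqrt{b_{p,q}(v)}\,e_{p,q}(v)$ and $\wp_{p,q}(v)(x)=\sqrt{b_{p,q}(v)}\,e_{p,q}(v)\otimes x$ for each basis vector $x$ whose first tensor factor is of the form $e_{q,t}(s)$, and $\wp_{p,q}(v)$ is zero on all other basis vectors. The matricial circular operators are $\zeta_{p,q}(u)=\wp_{p,q}(u')+\wp_{q,p}(u'')^*$, and $\Psi_k$ is the vector state on $B(\mathcal{M})$ defined by $\Omega_k$. *)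

(* Defs.v *)
From HB Require Import structures.
From mathcomp Require Import all_boot all_order all_algebra.
From mathcomp Require Import sesquilinear spectral complex.
From mathcomp Require Import all_classical all_reals all_analysis.
From mathcomp Require Import ring lra.

Set Implicit Arguments.
Unset Strict Implicit.
Unset Printing Implicit Defensive.

Import Order.TTheory GRing.Theory Num.Theory.
Import numFieldNormedType.Exports.

Local Open Scope classical_set_scope.
Local Open Scope ring_scope.
Local Open Scope complex_scope.
Local Open Scope sesquilinear_scope.

(* The squared modulus as an element of R (`|z| is an element of R[i]). *)
Definition cabs2 (R : realType) (z : R[i]) : R :=
  complex.Re z ^+ 2 + complex.Im z ^+ 2.

Lemma cabs2_ge0 (R : realType) (z : R[i]) : 0 <= cabs2 z.
Proof. by rewrite addr_ge0 ?sqr_ge0. Qed.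

Lemma cabs2_0 (R : realType) : cabs2 (0 : R[i]) = 0.
Proof. by rewrite /cabs2/= expr0n/= addr0. Qed.

Lemma cabs2M (R : realType) (a b : R[i]) : cabs2 (a * b) = cabs2 a * cabs2 b.
Proof. by rewrite /cabs2; case: a b => a1 a2 [b1 b2] /=; ring. Qed.

Section summation.
Context (R : realType).

(* Unordered sum of an absolutely summable family; esum only handles families
   of non-negative terms. *)
Definition rsum (I : choiceType) (f : I -> R) : R :=
  fine (\esum_(i in setT) (Num.max (f i) 0)%:E) -
  fine (\esum_(i in setT) (Num.max (- f i) 0)%:E).

Definition csum (I : choiceType) (f : I -> R[i]) : R[i] :=
  rsum (fun i => complex.Re (f i)) +i* rsum (fun i => complex.Im (f i)).

Definition rsummable (I : choiceType) (f : I -> R) : bool :=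
  summable setT (fun i => (f i)%:E).

Lemma le_rsummable (I : choiceType) (f g : I -> R) :
  (forall i, `|f i| <= `|g i|) -> rsummable g -> rsummable f.
Proof.
move=> fg; apply: le_lt_trans; apply: le_esum => i _.
by rewrite !abse_EFin lee_fin.
Qed.

Lemma rsummableD (I : choiceType) (f g : I -> R) :
  rsummable f -> rsummable g -> rsummable (fun i => f i + g i).
Proof. exact: summableD. Qed.

Lemma rsummableZ (I : choiceType) (a : R) (f : I -> R) :
  rsummable f -> rsummable (fun i => a * f i).
Proof.
move=> sf.
have sn n : rsummable (fun i => n%:R * f i).
  elim: n => [|n IHn].
    rewrite /rsummable /summable esum1 ?ltry//= => i _.
    by rewrite mul0r normr0.
  have := rsummableD IHn sf; congr rsummable; apply/funext => i.
  by rewrite -addn1 natrD; ring.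
apply: (le_rsummable _ (sn (Num.truncn `|a|).+1)) => i.
by rewrite !normrM ler_wpM2r// normr_nat ltW// truncnS_gt.
Qed.

Lemma rsummable_fin (I : choiceType) (f : I -> R) : (forall i, 0 <= f i) ->
  rsummable f -> \esum_(i in setT) (f i)%:E \is a fin_num.
Proof.
move=> f0; rewrite /rsummable summableE.
by under eq_esum do rewrite abse_EFin ger0_norm//.
Qed.

Lemma rsummable_reindex (I J : choiceType) (e : J -> I) (f : I -> R) :
  injective e -> rsummable f -> rsummable (f \o e).
Proof.
move=> einj; apply: le_lt_trans.
rewrite -(@esum_image R _ _ setT e (fun i => `|(f i)%:E|)%E); last by move=> x y _ _; exact: einj.
rewrite esum_mkcond; apply: le_esum => i _.
by case: ifP => // _.
Qed.

Lemma rsumE (I : choiceType) (f g h : I -> R) :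
  (forall i, 0 <= g i) -> (forall i, 0 <= h i) ->
  rsummable g -> rsummable h -> (forall i, f i = g i - h i) ->
  rsum f = fine (\esum_(i in setT) (g i)%:E) - fine (\esum_(i in setT) (h i)%:E).
Proof.
move=> g0 h0 sg sh fE.
have p0 i : 0 <= Num.max (f i) 0 by rewrite le_max lexx orbT.
have n0 i : 0 <= Num.max (- f i) 0 by rewrite le_max lexx orbT.
have sp : rsummable (fun i => Num.max (f i) 0).
  apply: le_rsummable sg => i; rewrite !ger0_norm// ge_max g0 andbT fE.
  by rewrite lerBlDr lerDl.
have sn : rsummable (fun i => Num.max (- f i) 0).
  apply: le_rsummable sh => i; rewrite !ger0_norm// ge_max h0 andbT fE.
  by rewrite opprB lerBlDr lerDl.
apply/eqP; rewrite /rsum subr_eq addrAC eq_sym subr_eq eq_sym; apply/eqP.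
rewrite -!fineD ?rsummable_fin// -!esumD//; [|by move=> *; rewrite lee_fin..].
congr fine; apply: eq_esum => i _; rewrite -!EFinD fE; congr EFin.
by rewrite opprB; case: (leP (g i - h i) 0); case: (leP (h i - g i) 0); lra.
Qed.

Lemma rsumD (I : choiceType) (f g : I -> R) : rsummable f -> rsummable g ->
  rsum (fun i => f i + g i) = rsum f + rsum g.
Proof.
move=> sf sg.
have p0 (a : R) : 0 <= Num.max a 0 by rewrite le_max lexx orbT.
have pa (a : R) : `|Num.max a 0| <= `|a|.
  by rewrite ger0_norm// ge_max normr_ge0 ler_norm.
have sP (u : I -> R) : rsummable u -> rsummable (fun i => Num.max (u i) 0).
  by apply: le_rsummable => i.
have sN (u : I -> R) : rsummable u -> rsummable (fun i => Num.max (- u i) 0).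
  by apply: le_rsummable => i; rewrite (le_trans (pa _))// normrN.
rewrite (@rsumE _ _ (fun i => Num.max (f i) 0 + Num.max (g i) 0)
                    (fun i => Num.max (- f i) 0 + Num.max (- g i) 0)).
- rewrite /rsum; under eq_esum do rewrite EFinD.
  rewrite esumD//; [|by move=> *; rewrite lee_fin..].
  under [X in _ - fine X]eq_esum do rewrite EFinD.
  rewrite esumD//; [|by move=> *; rewrite lee_fin..].
  rewrite !fineD ?rsummable_fin //; [|exact: sN|exact: sN|exact: sP|exact: sP].
  by rewrite opprD addrACA.
- by move=> i; rewrite addr_ge0.
- by move=> i; rewrite addr_ge0.
- exact: rsummableD (sP _ sf) (sP _ sg).
- exact: rsummableD (sN _ sf) (sN _ sg).
- move=> i.
  by case: (leP (f i) 0); case: (leP (- f i) 0); case: (leP (g i) 0);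
     case: (leP (- g i) 0); lra.
Qed.

Lemma rsum_reindex (I J : choiceType) (e : J -> I) (f : I -> R) :
  injective e -> (forall i, (forall j, i <> e j) -> f i = 0) ->
  rsum f = rsum (f \o e).
Proof.
move=> einj f0; have einj' : set_inj setT e by move=> x y _ _; exact: einj.
rewrite /rsum; congr (fine _ - fine _).
- rewrite -(@esum_image R _ _ setT e (fun i => (Num.max (f i) 0)%:E))//.
  rewrite [RHS]esum_mkcond; apply: eq_esum => i _.
  case: ifPn => // /negP ni; rewrite f0 ?maxxx// => j ij; apply: ni.
  by rewrite inE; exists j.
- rewrite -(@esum_image R _ _ setT e (fun i => (Num.max (- f i) 0)%:E))//.
  rewrite [RHS]esum_mkcond; apply: eq_esum => i _.
  case: ifPn => // /negP ni; rewrite f0 ?oppr0 ?maxxx// => j ij; apply: ni.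
  by rewrite inE; exists j.
Qed.

Lemma csumD (I : choiceType) (f g : I -> R[i]) :
  rsummable (fun i => complex.Re (f i)) -> rsummable (fun i => complex.Im (f i)) ->
  rsummable (fun i => complex.Re (g i)) -> rsummable (fun i => complex.Im (g i)) ->
  csum (fun i => f i + g i) = csum f + csum g.
Proof.
move=> fr fi gr gi; rewrite /csum.
rewrite (_ : (fun i => complex.Re (f i + g i)) =
             (fun i => complex.Re (f i) + complex.Re (g i))); last first.
  by apply/funext => i; case: (f i); case: (g i).
rewrite (_ : (fun i => complex.Im (f i + g i)) =
             (fun i => complex.Im (f i) + complex.Im (g i))); last first.
  by apply/funext => i; case: (f i); case: (g i).
by rewrite !rsumD.
Qed.

Lemma csum_reindex (I J : choiceType) (e : J -> I) (f : I -> R[i]) :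
  injective e -> (forall i, (forall j, i <> e j) -> f i = 0) ->
  csum f = csum (f \o e).
Proof.
move=> einj f0; rewrite /csum (rsum_reindex einj) => [|i /f0->//].
by rewrite [in X in _ +i* X](rsum_reindex einj) => [|i /f0->//].
Qed.

Lemma rsum_unit (I : choiceType) (f : I -> R) (i0 : I) :
  (forall i, i != i0 -> f i = 0) -> rsum f = f i0.
Proof.
move=> f0; rewrite (@rsum_reindex _ unit (fun=> i0)); last 2 first.
- by move=> [] [].
- by move=> i ne; apply: f0; apply/eqP; exact: (ne tt).
rewrite /rsum/= (_ : [set: unit] = [set tt]); last by apply/seteqP; split=> -[].
rewrite !esum_set1/= ?lee_fin ?le_max ?lexx ?orbT//.
by case: (leP (f i0) 0); case: (leP (- f i0) 0); lra.
Qed.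

Lemma csum_unit (I : choiceType) (f : I -> R[i]) (i0 : I) :
  (forall i, i != i0 -> f i = 0) -> csum f = f i0.
Proof.
move=> f0; rewrite /csum !(@rsum_unit _ _ i0); first by case: (f i0).
- by move=> i /f0->.
- by move=> i /f0->.
Qed.

End summation.

Section l2_space.
Context (R : realType) (I : choiceType).

Definition square_summable : {pred I -> R[i]} :=
  fun x => rsummable (fun i => cabs2 (x i)).

Lemma square_summable_submod_closed : submod_closed square_summable.
Proof.
split=> [|a x y].
  rewrite unfold_in /rsummable /summable esum1 ?ltry//= => i _.
  by rewrite /cabs2/= expr0n/= addr0 normr0.
rewrite !unfold_in => sx sy.
apply: le_rsummable (rsummableD (rsummableZ (2 * cabs2 a) sx) (rsummableZ 2 sy)).
move=> i; rewrite !ger0_norm ?cabs2_ge0//; last first.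
  by rewrite addr_ge0// !mulr_ge0// cabs2_ge0.
change ((a *: x + y) i) with (a * x i + y i).
rewrite /cabs2; case: a (x i) (y i) => a1 a2 [x1 x2] [y1 y2] /=.
rewrite -subr_ge0 (_ : _ - _ = (a1 * x1 - a2 * x2 - y1) ^+ 2 +
  (a1 * x2 + a2 * x1 - y2) ^+ 2); last by ring.
by rewrite addr_ge0 ?sqr_ge0.
Qed.

HB.instance Definition _ :=
  GRing.isSubmodClosed.Build _ _ square_summable square_summable_submod_closed.

Record l2 := L2 { l2val :> I -> R[i]; l2P : l2val \in square_summable }.

HB.instance Definition _ := [isSub for l2val].
HB.instance Definition _ := gen_eqMixin l2.
HB.instance Definition _ := gen_choiceMixin l2.
HB.instance Definition _ := [SubChoice_isSubLmodule of l2 by <:].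

Definition dot (x y : l2) : R[i] := csum (fun i => x i * (y i)^*).

Definition hnorm (x : l2) : R := Num.sqrt (complex.Re (dot x x)).

Lemma l2_eq (x y : l2) : (forall i, x i = y i) -> x = y.
Proof. by move=> xy; apply/val_inj/funext. Qed.

Lemma l2D (x y : l2) i : (x + y) i = x i + y i. Proof. by []. Qed.

Lemma l2Z (a : R[i]) (x : l2) i : (a *: x) i = a * x i. Proof. by []. Qed.

Lemma delta_subproof (i0 : I) :
  (fun i => (i == i0)%:R : R[i]) \in square_summable.
Proof.
rewrite unfold_in /rsummable /summable (esumID [set i0])//= setTI.
rewrite esum_set1// eqxx esum1 ?adde0 ?ltry// => i [_ /= ni].
rewrite (negbTE (introN eqP ni)).
by rewrite /cabs2/= expr0n/= addr0 normr0.
Qed.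

Definition delta (i0 : I) : l2 := L2 (delta_subproof i0).

Lemma dot_delta (x : l2) (i : I) : dot x (delta i) = x i.
Proof.
rewrite /dot (@csum_unit _ _ _ i) => [|j /negPf nj] /=.
  by rewrite eqxx rmorph1 mulr1.
by rewrite nj rmorph0 mulr0.
Qed.

Lemma rsummable_mul (f g : I -> R) : rsummable (fun i => f i ^+ 2) ->
  rsummable (fun i => g i ^+ 2) -> rsummable (fun i => f i * g i).
Proof.
move=> sf sg; apply: le_rsummable (rsummableD sf sg) => i.
rewrite [leRHS]ger0_norm ?addr_ge0 ?sqr_ge0// normrM.
rewrite -(real_normK (num_real (f i))) -(real_normK (num_real (g i))).
have := sqr_ge0 (`|f i| - `|g i|); have := sqr_ge0 (`|f i| + `|g i|); nra.
Qed.

Lemma dot_summable (x y : l2) :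
  rsummable (fun i => complex.Re (x i * (y i)^*)) /\
  rsummable (fun i => complex.Im (x i * (y i)^*)).
Proof.
have sr (z : l2) : rsummable (fun i => complex.Re (z i) ^+ 2).
  apply: le_rsummable (l2P z) => i; rewrite !ger0_norm ?cabs2_ge0 ?sqr_ge0//.
  by rewrite lerDl sqr_ge0.
have si (z : l2) : rsummable (fun i => complex.Im (z i) ^+ 2).
  apply: le_rsummable (l2P z) => i; rewrite !ger0_norm ?cabs2_ge0 ?sqr_ge0//.
  by rewrite lerDr sqr_ge0.
split.
- have := rsummableD (rsummable_mul (sr x) (sr y)) (rsummable_mul (si x) (si y)).
  congr rsummable; apply/funext => i.
  by case: (x i) (y i) => a b [c e] /=; ring.
- have := rsummableD (rsummable_mul (si x) (sr y))
    (rsummableZ (-1) (rsummable_mul (sr x) (si y))).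
  congr rsummable; apply/funext => i.
  by case: (x i) (y i) => a b [c e] /=; ring.
Qed.

Lemma dotDl (x y z : l2) : dot (x + y) z = dot x z + dot y z.
Proof.
rewrite /dot -csumD; [|exact: (dot_summable _ _).1|exact: (dot_summable _ _).2|
  exact: (dot_summable _ _).1|exact: (dot_summable _ _).2].
by congr csum; apply/funext => i; rewrite l2D mulrDl.
Qed.

Lemma dotDr (x y z : l2) : dot x (y + z) = dot x y + dot x z.
Proof.
rewrite /dot -csumD; [|exact: (dot_summable _ _).1|exact: (dot_summable _ _).2|
  exact: (dot_summable _ _).1|exact: (dot_summable _ _).2].
by congr csum; apply/funext => i; rewrite l2D rmorphD mulrDr.
Qed.

Lemma rsumN (f : I -> R) : rsum (fun i => - f i) = - rsum f.
Proof.
by rewrite /rsum opprB; under [in X in _ - X]eq_esum do rewrite opprK.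
Qed.

Lemma dotC (x y : l2) : dot y x = (dot x y)^*.
Proof.
rewrite /dot /csum /=; congr (_ +i* _).
  by congr rsum; apply/funext => i; case: (x i) (y i) => a b [c e] /=; ring.
rewrite -rsumN.
by congr rsum; apply/funext => i; case: (x i) (y i) => a b [c e] /=; ring.
Qed.

Lemma hnorm2E (x : l2) :
  (hnorm x ^+ 2)%:E = \esum_(i in setT) (cabs2 (x i))%:E.
Proof.
have E : complex.Re (dot x x) = fine (\esum_(i in setT) (cabs2 (x i))%:E).
  rewrite /dot /csum /=; rewrite (@rsumE _ _ _ (fun i => cabs2 (x i)) (fun=> 0)).
  - by rewrite [X in _ - fine X]esum1// subr0.
  - by move=> i; exact: cabs2_ge0.
  - by [].
  - exact: l2P.
  - by rewrite /rsummable /summable esum1 ?ltry// => i _; rewrite abse0.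
  - by move=> i; rewrite /cabs2; case: (x i) => a b /=; ring.
rewrite /hnorm sqr_sqrtr; last first.
  by rewrite E fine_ge0// esum_ge0// => i _; rewrite lee_fin cabs2_ge0.
rewrite E fineK// rsummable_fin//; [by move=> i; exact: cabs2_ge0 | exact: l2P].
Qed.

Definition bounded_operator (S : l2 -> l2) : Prop :=
  [/\ forall x y, S (x + y) = S x + S y, forall a x, S (a *: x) = a *: S x &
      exists c : R, forall x, hnorm (S x) <= c * hnorm x].

Definition is_adjoint (S S' : l2 -> l2) : Prop :=
  forall x y, dot (S x) y = dot x (S' y).

(* is_adjoint_unique shows that S has at most one adjoint; the default value is
   not reached for the operators used below (is_adjoint_zeta). *)
Definition adjoint (S : l2 -> l2) : l2 -> l2 := xget (fun=> 0) (is_adjoint S).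

Lemma is_adjoint_unique (S S1 S2 : l2 -> l2) :
  is_adjoint S S1 -> is_adjoint S S2 -> S1 = S2.
Proof.
move=> h1 h2; apply/funext => y; apply: l2_eq => i.
by rewrite -!dot_delta dotC -h1 h2 -dotC.
Qed.

Lemma adjointE (S S' : l2 -> l2) : is_adjoint S S' -> adjoint S = S'.
Proof.
move=> h; rewrite /adjoint; case: xgetP => [S'' _ h''|/(_ S')//].
exact: is_adjoint_unique h'' h.
Qed.

Lemma is_adjoint_sym (S S' : l2 -> l2) : is_adjoint S S' -> is_adjoint S' S.
Proof. by move=> h x y; rewrite dotC -h -dotC. Qed.

Lemma is_adjointD (S1 S2 S1' S2' : l2 -> l2) :
  is_adjoint S1 S1' -> is_adjoint S2 S2' ->
  is_adjoint (fun x => S1 x + S2 x) (fun x => S1' x + S2' x).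
Proof. by move=> h1 h2 x y; rewrite dotDl dotDr h1 h2. Qed.

End l2_space.

Section fock_space.
Context (R : realType) (r : nat) (U : finType).

(* ([:: (p1, v1); ...; (pm, vm)], q) indexes the basis vector
   e_{p1,p2}(v1) (x) e_{p2,p3}(v2) (x) ... (x) e_{pm,q}(vm), and ([::], q)
   indexes Omega_q.  The letters u' and u'' are inl u and inr u. *)
Definition fock_basis : choiceType := (seq ('I_r * (U + U)) * 'I_r)%type.

Local Notation fock := (l2 R fock_basis).

Definition vacuum (q : 'I_r) : fock := delta R ([::], q).

(* The q such that x is Omega_q or has a first factor of the form e_{q,t}(s). *)
Definition left_index (x : fock_basis) : 'I_r :=
  if x.1 is (p, _) :: _ then p else x.2.

(* The index of e_{p,q}(v) (x) x, where q = left_index x. *)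
Definition prepend (p : 'I_r) (v : U + U) (x : fock_basis) : fock_basis :=
  ((p, v) :: x.1, x.2).

Definition base_letter (v : U + U) : U :=
  match v with inl u => u | inr u => u end.

Variable B : U -> 'M[R]_r.

Definition coef (p q : 'I_r) (v : U + U) : R[i] :=
  (Num.sqrt (B (base_letter v) p q))%:C.

Definition creation_fun (p q : 'I_r) (v : U + U) (x : fock_basis -> R[i])
    (y : fock_basis) : R[i] :=
  if y.1 is (p', v') :: w then
    if [&& p' == p, v' == v & left_index (w, y.2) == q]
    then coef p q v * x (w, y.2) else 0
  else 0.

Lemma prepend_inj p v : injective (prepend p v).
Proof. by move=> [w k] [w' k'] [-> ->]. Qed.

Lemma creation_fun_prepend p q v x y : creation_fun p q v x (prepend p v y) =
  if left_index y == q then coef p q v * x y else 0.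
Proof. by case: y => w k; rewrite /creation_fun/= !eqxx. Qed.

Lemma creation_fun_out p q v x y :
  (forall z, y <> prepend p v z) -> creation_fun p q v x y = 0.
Proof.
case: y => -[|[p' v'] w] k //= ne; rewrite /creation_fun/=.
case: ifP => // /and3P[/eqP pp /eqP vv _]; case: (ne (w, k)).
by rewrite pp vv.
Qed.

Lemma esum_creation p q v (x : fock_basis -> R[i]) (G : R[i] -> \bar R) :
  G 0 = 0%E ->
  \esum_(y in setT) G (creation_fun p q v x y) =
  \esum_(y in setT) G (if left_index y == q then coef p q v * x y else 0).
Proof.
move=> G0.
under [RHS]eq_esum do rewrite -creation_fun_prepend.
rewrite -(@esum_image R _ _ setT (prepend p v)
  (fun y => G (creation_fun p q v x y))).
  rewrite [RHS]esum_mkcond; apply: eq_esum => y _.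
  case: ifPn => // /negP ny; rewrite creation_fun_out// => z yz; apply: ny.
  by rewrite inE; exists z.
by move=> ? ? _ _; exact: prepend_inj.
Qed.

Lemma creation_subproof p q v (x : fock) :
  creation_fun p q v x \in @square_summable R fock_basis.
Proof.
rewrite unfold_in /rsummable /summable.
rewrite (@esum_creation _ _ _ _ (fun z => `|(cabs2 z)%:E|)%E); last first.
  by rewrite cabs2_0 abse0.
apply: le_rsummable (rsummableZ (cabs2 (coef p q v)) (l2P x)) => y.
by case: ifP => _; rewrite ?cabs2M// cabs2_0 normr0.
Qed.

(* The formula is the one for coordinates; creation_delta below gives the
   action on the orthonormal basis and creation_bounded the boundedness. *)
Definition creation p q v (x : fock) : fock := L2 (creation_subproof p q v x).

Lemma creation_delta p q v (x : fock_basis) :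
  creation p q v (delta R x) =
  if left_index x == q then coef p q v *: delta R (prepend p v x) else 0.
Proof.
apply: l2_eq => y.
have [[z ->]|ne] := pselect (exists z, y = prepend p v z); last first.
  rewrite [LHS]creation_fun_out => [|z yz]; last by apply: ne; exists z.
  case: ifP => // _; rewrite l2Z /=.
  case: eqP => [yx|_]; last by rewrite mulr0.
  by case: ne; exists x.
rewrite [LHS]creation_fun_prepend/=.
have [->|zx] := eqVneq z x.
  by case: ifP => // _; rewrite l2Z/= eqxx.
have -> : (if left_index x == q then coef p q v *: delta R (prepend p v x)
  else 0) (prepend p v z) = 0.
  case: ifP => // _; rewrite l2Z/= (inj_eq (@prepend_inj p v)).
  by rewrite (negbTE zx) mulr0.
by rewrite mulr0 if_same.
Qed.

Lemma creation_bounded p q v : bounded_operator (creation p q v).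
Proof.
split.
- move=> x y; apply: l2_eq => -[[|[p' v'] w] k]; rewrite l2D/=.
    by rewrite /creation_fun/= addr0.
  by rewrite /creation_fun/=; case: ifP => _; [exact: mulrDr|rewrite addr0].
- move=> a x; apply: l2_eq => -[[|[p' v'] w] k]; rewrite l2Z/=.
    by rewrite /creation_fun/= mulr0.
  by rewrite /creation_fun/=; case: ifP => _; [exact: mulrCA|rewrite mulr0].
exists (Num.sqrt (cabs2 (coef p q v))) => x.
rewrite -(@ler_pXn2r _ 2)// ?nnegrE ?mulr_ge0 ?sqrtr_ge0//.
rewrite exprMn (sqr_sqrtr (cabs2_ge0 _)) -lee_fin (EFinM _ (hnorm x ^+ 2)).
rewrite !hnorm2E.
rewrite (@esum_creation _ _ _ _ (fun z => (cabs2 z)%:E)); last first.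
  by rewrite cabs2_0.
apply: (@le_trans _ _
  (\esum_(y in setT) ((cabs2 (coef p q v))%:E * (cabs2 (x y))%:E))%E).
  apply: le_esum => y _; case: ifP => _; first by rewrite cabs2M EFinM.
  by rewrite cabs2_0 mule_ge0 // lee_fin cabs2_ge0.
apply: ge_ereal_sup => _ [F [finF _] <-].
rewrite -ge0_mule_fsumr; last by move=> y; rewrite lee_fin cabs2_ge0.
rewrite lee_wpmul2l ?lee_fin ?cabs2_ge0//.
by apply: ereal_sup_ubound; exists F.
Qed.

Lemma annihilation_subproof p q v (x : fock) :
  (fun y => if left_index y == q then coef p q v * x (prepend p v y) else 0)
    \in @square_summable R fock_basis.
Proof.
apply: le_rsummable (rsummableZ (cabs2 (coef p q v))
  (rsummable_reindex (@prepend_inj p v) (l2P x))) => y.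
by case: ifP => _; rewrite ?cabs2M// cabs2_0 normr0.
Qed.

Definition annihilation p q v (x : fock) : fock :=
  L2 (annihilation_subproof p q v x).

Lemma is_adjoint_creation p q v :
  is_adjoint (creation p q v) (annihilation p q v).
Proof.
move=> x y; rewrite /dot (csum_reindex (@prepend_inj p v)); last first.
  by move=> i ni /=; rewrite creation_fun_out ?mul0r.
congr csum; apply/funext => z; rewrite /= creation_fun_prepend.
case: ifP => _; last by rewrite mul0r rmorph0 mulr0.
rewrite rmorphM/= mulrA; congr (_ * _); rewrite mulrC; congr (_ * _).
by rewrite /coef; apply/eqP; rewrite eq_complex/= oppr0 !eqxx.
Qed.

Lemma adjoint_creation p q v :
  adjoint (creation p q v) = annihilation p q v.
Proof. exact/adjointE/is_adjoint_creation. Qed.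

Definition zeta (p q : 'I_r) (u : U) (x : fock) : fock :=
  creation p q (inl u) x + adjoint (creation q p (inr u)) x.

Lemma is_adjoint_zeta p q u : is_adjoint (zeta p q u) (adjoint (zeta p q u)).
Proof.
have h : is_adjoint (zeta p q u)
    (fun x => annihilation p q (inl u) x + creation q p (inr u) x).
  rewrite /zeta adjoint_creation; apply: is_adjointD.
    exact: is_adjoint_creation.
  exact/is_adjoint_sym/is_adjoint_creation.
by rewrite (adjointE h).
Qed.

Definition Psi (k : 'I_r) (S : fock -> fock) : R[i] :=
  dot (S (vacuum k)) (vacuum k).

End fock_space.

(* The exponent epsilon in {1, *}; true stands for the star. *)
Definition star_op (R : realType) (I : choiceType) (eps : bool)
    (S : l2 R I -> l2 R I) : l2 R I -> l2 R I :=
  if eps then adjoint S else S.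

Definition star_mx (R : realType) (n : nat) (eps : bool) (A : 'M[R[i]]_n) :
    'M[R[i]]_n :=
  if eps then A ^t* else A.

Section random_matrices.
Context d (T : measurableType d) (R : realType) (P : probability T R).

Definition cexpect (Z : T -> R[i]) : R[i] :=
  fine 'E_P[fun t => complex.Re (Z t)] +i* fine 'E_P[fun t => complex.Im (Z t)].

(* The centered normal law of standard deviation s.  The case s = 0 is apart
   because the library's normal_prob 0 0 is not the Dirac mass at 0. *)
Definition gauss (s : R) (A : set (measurableTypeR R)) : \bar R :=
  if s == 0 then \d_(0 : measurableTypeR R) A else normal_prob 0 s A.

(* Real and imaginary parts independent, both centered normal of standard
   deviation s, so that the expectation of |Z|^2 is 2 s^2; s = 0 is allowed. *)
Definition circular_gaussian (Z : T -> R[i]) : Prop :=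
  [/\ measurable_fun setT (fun t => complex.Re (Z t) : measurableTypeR R),
      measurable_fun setT (fun t => complex.Im (Z t) : measurableTypeR R) &
      exists2 s : R, 0 <= s &
        forall A B : set (measurableTypeR R), measurable A -> measurable B ->
          P [set t | A (complex.Re (Z t)) /\ B (complex.Im (Z t))] =
          (gauss s A * gauss s B)%E].

(* Borel sets of the complex plane are those of R * R. *)
Definition mutually_independent (I : finType) (Z : I -> T -> R[i]) : Prop :=
  forall (J : {set I}) (A : I -> set (measurableTypeR R * measurableTypeR R)),
    (forall i, measurable (A i)) ->
    P [set t | forall i, i \in J ->
         A i (complex.Re (Z i t), complex.Im (Z i t))] =
    (\prod_(i in J)
       P [set t | A i (complex.Re (Z i t), complex.Im (Z i t))])%E.

End random_matrices.

Section blocks.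
Context (r n : nat).

Definition interval_partition (N : 'I_r -> {set 'I_n}) : Prop :=
  [/\ forall q, exists i, i \in N q,
      forall p q i, i \in N p -> i \in N q -> p = q,
      forall i, exists q, i \in N q &
      forall q (i j k : 'I_n), i \in N q -> k \in N q ->
        (i <= j <= k)%N -> j \in N q].

Variables (R : realType) (N : 'I_r -> {set 'I_n}).

Definition proj_mx (q : 'I_r) : 'M[R[i]]_n :=
  \matrix_(i, j) ((i == j) && (i \in N q))%:R.

Definition block (p q : 'I_r) (A : 'M[R[i]]_n) : 'M[R[i]]_n :=
  proj_mx p *m A *m proj_mx q.

Definition partial_trace d (T : measurableType d) (P : probability T R)
    (k : 'I_r) (X : T -> 'M[R[i]]_n) : R[i] :=
  (#|N k|%:R)^-1 * cexpect P (fun t => \sum_(i in N k) X t i i).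

End blocks.

(* Main.v *)
Require Import Defs.
From HB Require Import structures.
From mathcomp Require Import all_boot all_order all_algebra.
From mathcomp Require Import complex.
From mathcomp Require Import all_classical all_reals all_analysis.
From mathcomp Require Import measurable_realfun.
From mathcomp Require Import zify ring lra.
From mathcomp Require mpoly.
Import (canonicals, coercions) mpoly.

(** Products of traces cannot be avoided: a splitting yields the expectation of a product of two
    traces, which does not factor for finite [n]. Carrying all products through one induction makes
    the factorization in the limit part of its conclusion, so that no variance estimate is needed.
    Pairings are never enumerated either; the recursion alone determines the limits. The expectation
    is treated as an additive functional on a ring of formal polynomials in the real and imaginary
    parts of the entries. Derivatives are then algebraic, and integrability is a question about
    monomials. Stars are absorbed into the letters: [inl u] stands for Y(u) and [inr u] for its
    adjoint, and the same sum type labels u' and u'' on the Fock space, so both sides speak of the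
    same words. An entry of the adjoint in block (a, b) is a conjugated entry of block (b, a);
    symmetry of V(u) gives both letters the same variance. The limit weight d_b v of a splitting is
    an entry of DV(u). On the Fock space it arises as the product of two equal square roots, one
    from creating a factor and one from annihilating it. *)

(** Gaussian integration by parts, applied to the first letter of a word,
expresses the expectation of a product of block traces of words through words
with two letters less: either the letter is paired inside its own word, which
splits the word into two cyclic words, or it is paired with a letter of another
word, which merges the two.  After division by the block sizes a splitting comes
with the factor v n_b / n, which tends to v d_b, and a merging with v / (n n_a),
which is O(1/n) even if d_a = 0.  By induction on the length, the expectations
of products of normalized traces converge to products of numbers that satisfy
the splitting recursion.  On the Fock space the vacuum moments of the matricial
circular operators satisfy the same recursion: the first letter has to
annihilate the vector that was created last, and cutting the word at that
creation gives the two factors. *)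

Set Implicit Arguments.
Unset Strict Implicit.
Unset Printing Implicit Defensive.

Import Order.TTheory GRing.Theory Num.Theory.
Import numFieldNormedType.Exports.

Local Open Scope classical_set_scope.
Local Open Scope ring_scope.
Local Open Scope complex_scope.

(** * Measures given by a density *)

Section density.
Import HBNNSimple.
Context d d' (T : measurableType d) (S : measurableType d') (R : realType).
Variables (X : T -> S) (mX : measurable_fun setT X).
Variables (mu : {measure set T -> \bar R}) (nu : {measure set S -> \bar R}).
Variables (G : T -> R) (G0 : forall t, 0 <= G t) (mG : measurable_fun setT G).
Hypothesis nuE : forall A, measurable A ->
  nu A = (\int[mu]_t (G t * \1_A (X t))%:E)%E.

Let mindic A : measurable A -> measurable_fun setT (fun t => \1_A (X t) : R).
Proof.
by move=> mA; apply: measurableT_comp => //; exact: measurable_indic.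
Qed.

Let density_nnsfun (f : {nnsfun S >-> R}) :
  (\int[nu]_x (f x)%:E = \int[mu]_t (G t * f (X t))%:E)%E.
Proof.
have mE (r : R) : measurable_fun setT
    (fun t => (G t * \1_(f @^-1` [set r]) (X t))%:E).
  apply/measurable_EFinP; apply: measurable_funM => //.
  by apply: mindic.
have -> : (\int[mu]_t (G t * f (X t))%:E =
  \int[mu]_t (\sum_(r \in range f)
     (r%:E * (G t * \1_(f @^-1` [set r]) (X t))%:E)))%E.
  apply: eq_integral => t _; rewrite fimfunE EFinM.
  rewrite -fsumEFin// ge0_mule_fsumr; last first.
    by move=> r; rewrite EFinM nnfun_muleindic_ge0.
  by apply: eq_fsbigr => r _; rewrite -!EFinM mulrCA.
under [LHS]eq_integral do rewrite fimfunE -fsumEFin//.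
rewrite [LHS]ge0_integral_fsum//; last 2 first.
  - by move=> r; exact/measurable_EFinP/measurableT_comp.
  - by move=> n x _; rewrite EFinM nnfun_muleindic_ge0.
rewrite [RHS]ge0_integral_fsum//; last 2 first.
  - move=> r; exact: measurable_funeM.
  - move=> r t _; rewrite -EFinM mulrCA EFinM mule_ge0 ?lee_fin//.
    by rewrite -lee_fin EFinM nnfun_muleindic_ge0.
apply: eq_fsbigr => r _.
rewrite integralZl_indic_nnsfun// integral_indic// setIT.
have [r0|r0] := leP 0 r; last first.
  have e0 : f @^-1` [set r] = set0 by exact: preimage_nnfun0.
  rewrite e0 measure0 mule0 integral0_eq// => t _.
  by rewrite indic0 mulr0 mule0.
rewrite ge0_integralZl//; last first.
  by move=> t _; rewrite lee_fin mulr_ge0.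
by rewrite nuE.
Qed.

(** The hypothesis on [nu] makes it the image under [X] of the measure with density [G] with respect
    to [mu]; simple functions and monotone convergence carry this from sets to integrands. It serves
    for the normal density, with [X] the identity, and for one factor of a product of independent
    variables, with [G] the product of the other factors. *)
Lemma ge0_integral_density (f : S -> R) :
  measurable_fun setT f -> (forall x, 0 <= f x) ->
  (\int[nu]_x (f x)%:E = \int[mu]_t (G t * f (X t))%:E)%E.
Proof.
move=> mf f0.
have mf' : measurable_fun setT (EFin \o f) by exact/measurable_EFinP.
have f0' x : (0 <= (EFin \o f) x)%E by rewrite lee_fin.
pose f_ := nnsfun_approx measurableT mf'.
transitivity (lim (\int[nu]_x (f_ n x)%:E @[n --> \oo])%E).
  rewrite -monotone_convergence//=.
  - apply: eq_integral => ? /[!inE] xD; apply/esym/cvg_lim => //=.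
    exact: cvg_nnsfun_approx.
  - by move=> n; exact/measurable_EFinP/measurable_funTS.
  - by move=> n ? _; rewrite lee_fin.
  - by move=> ? _ ? ? mn; rewrite lee_fin; exact/lefP/nd_nnsfun_approx.
transitivity (lim (\int[mu]_t (G t * f_ n (X t))%:E @[n --> \oo])%E).
  by apply: congr_lim; apply/funext => n /=; exact: density_nnsfun.
rewrite -monotone_convergence//=.
- apply: eq_integral => t _; apply/cvg_lim => //=.
  under eq_fun do rewrite EFinM; rewrite EFinM.
  apply: cvgeZl => //.
  exact: cvg_nnsfun_approx.
- move=> n; apply/measurable_EFinP; apply: measurable_funM => //.
  exact: measurableT_comp.
- by move=> n t _; rewrite lee_fin mulr_ge0.
- move=> t _ m n mn; rewrite lee_fin ler_wpM2l//.
  exact/lefP/nd_nnsfun_approx.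
Qed.

Lemma integral_density (f : S -> R) : measurable_fun setT f ->
  mu.-integrable setT (fun t => (G t * f (X t))%:E) ->
  nu.-integrable setT (fun x => (f x)%:E) /\
  (\int[nu]_x (f x)%:E = \int[mu]_t (G t * f (X t))%:E)%E.
Proof.
move=> mf /integrableP[mGf fGf].
have ffi : nu.-integrable setT (fun x => (f x)%:E).
  apply/integrableP; split; first exact/measurable_EFinP.
  apply: le_lt_trans fGf; rewrite (@ge0_integral_density (fun x => `|f x|)).
  - apply: ge0_le_integral => //.
    + by move=> t _; rewrite lee_fin mulr_ge0.
    + apply/measurable_EFinP; apply: measurable_funM => //.
      by apply: measurableT_comp => //; exact: measurableT_comp.
    + exact: measurableT_comp.
    + by move=> t _; rewrite abse_EFin lee_fin normrM (ger0_norm (G0 t)).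
  - exact: measurableT_comp.
  - by move=> x.
split => //.
rewrite [LHS]integralE [RHS]integralE; congr (_ - _)%E.
- have E : ((fun x => (f x)%:E)^\+ = fun x => (Num.max (f x) 0)%:E)%E.
    by apply/funext => x; rewrite funeposE EFin_max.
  rewrite E ge0_integral_density//; last 2 first.
  + exact: measurable_maxr.
  + by move=> x; rewrite le_max lexx orbT.
  apply: eq_integral => t _; rewrite funeposE -EFin_max; congr EFin.
  by rewrite maxr_pMr// mulr0.
- have E : ((fun x => (f x)%:E)^\- = fun x => (Num.max (- f x) 0)%:E)%E.
    by apply/funext => x; rewrite funenegE EFin_max.
  rewrite E ge0_integral_density//; last 2 first.
  + by apply: measurable_maxr => //; exact: measurable_funN.
  + by move=> x; rewrite le_max lexx orbT.
  apply: eq_integral => t _; rewrite funenegE -EFinN -EFin_max; congr EFin.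
  by rewrite maxr_pMr// mulr0 mulrN.
Qed.

End density.

(** * Products of independent variables *)

Section independent_products.
Context d d' (T : measurableType d) (S : measurableType d') (R : realType)
  (P : probability T R) (B : finType).
Variables (X : B -> T -> S) (mX : forall b, measurable_fun setT (X b)).
Variable nu : B -> probability S R.
Hypothesis indep : forall A : B -> set S, (forall b, measurable (A b)) ->
  P [set t | forall b, A b (X b t)] = (\prod_b nu b (A b))%E.

Lemma measurable_prod_comp (f : B -> S -> R) (r : seq B) (Q : pred B) :
  (forall b, measurable_fun setT (f b)) ->
  measurable_fun setT (fun t => \prod_(b <- r | Q b) f b (X b t)).
Proof.
move=> mf; rewrite (_ : (fun t => _) =
  (fun t => \prod_(b <- [seq b <- r | Q b]) f b (X b t))); last first.
  by apply/funext => t; rewrite big_filter.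
by apply: measurable_prod => b _; exact: measurableT_comp.
Qed.

(** Induction on the number of factors not yet known to be indicators; with none left, the claim is
    the independence hypothesis. To free a factor [b], the measure whose density [G] is the product
    of the other factors is pushed forward by [X b]: by induction, with an indicator at [b], the
    result is [nu b] scaled by the constant [C]. *)
Lemma ge0_expectation_prod (f : B -> S -> R) (c : B -> R) :
  (forall b, measurable_fun setT (f b)) -> (forall b x, 0 <= f b x) ->
  (forall b, \int[nu b]_x (f b x)%:E = (c b)%:E)%E ->
  (\int[P]_t (\prod_b f b (X b t))%:E = (\prod_b c b)%:E)%E.
Proof.
suff H n : forall (J : {set B}) (f : B -> S -> R) (c : B -> R), #|J| = n ->
  (forall b, b \notin J -> exists2 A, measurable A & f b = \1_A) ->
  (forall b, measurable_fun setT (f b)) -> (forall b x, 0 <= f b x) ->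
  (forall b, \int[nu b]_x (f b x)%:E = (c b)%:E)%E ->
  (\int[P]_t (\prod_b f b (X b t))%:E = (\prod_b c b)%:E)%E.
  move=> mf f0 fc; apply: (H #|[set: B]|%SET [set: B]%SET) => // b.
  by rewrite inE.
elim: n => [|n IH] J {}f {}c cJ fJ mf f0 fc.
  move/eqP: cJ; rewrite cards_eq0 => /eqP J0.
  have /fin_all_exists[A HA] b : exists A, measurable A /\ f b = \1_A.
    by have [|A mA ->] := fJ b; [rewrite J0 inE|exists A].
  have -> : (fun t => (\prod_b f b (X b t))%:E) =
      (fun t => (\1_[set t | forall b, A b (X b t)] t)%:E).
    apply/funext => t; congr EFin.
    have [At|/existsNP[b nA]] := pselect (forall b, A b (X b t)).
      rewrite indicE mem_set// big1// => b _.
      by rewrite (HA b).2 indicE mem_set.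
    rewrite indicE memNset; last by move=> /(_ b).
    by rewrite (bigD1 b)//= (HA b).2 indicE memNset// mul0r.
  have mS : measurable [set t | forall b, A b (X b t)].
    have -> : [set t | forall b, A b (X b t)] =
      \bigcap_(b in [set` enum B]) (X b @^-1` A b).
      apply/seteqP; split => t /= h b; last by apply: h; rewrite /= mem_enum.
      by move=> _; exact: h.
    apply: fin_bigcap_measurable => [|b _]; first exact: finite_finset.
    rewrite -[X in measurable X]setTI.
    by apply: mX => //; exact: (HA b).1.
  rewrite integral_indic// setIT; apply: (etrans (indep (fun b => (HA b).1))).
  rewrite -prodEFin; apply: eq_bigr => b _.
  rewrite -fc (HA b).2 integral_indic ?setIT//; exact: (HA b).1.
have [b bJ] : exists b, b \in J by apply/set0Pn; rewrite -card_gt0 cJ.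
pose C := \prod_(b' | b' != b) c b'.
have c0 b' : 0 <= c b'.
  by rewrite -lee_fin -fc integral_ge0// => x _; rewrite lee_fin.
have C0 : 0 <= C by apply: prodr_ge0.
pose G t := \prod_(b' | b' != b) f b' (X b' t).
have GE g t : \prod_b' (if b' == b then g else f b') (X b' t) = G t * g (X b t).
  rewrite (bigD1 b)//= eqxx mulrC; congr (_ * _).
  by apply: eq_bigr => b' /negPf->.
have G0 t : 0 <= G t by apply: prodr_ge0.
have mG : measurable_fun setT G by exact: measurable_prod_comp.
transitivity (\int[P]_t (G t * f b (X b t))%:E)%E.
  apply: eq_integral => t _; congr EFin; rewrite -GE; apply: eq_bigr => b' _.
  by case: eqP => // ->.
rewrite -(@ge0_integral_density _ _ _ _ _ (X b) _ _
  (mscale (NngNum C0) (nu b)))//.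
  rewrite ge0_integral_mscale//=; last first.
  - by move=> x _; rewrite lee_fin.
  - exact/measurable_EFinP.
  by rewrite fc -EFinM (bigD1 b)//= mulrC.
move=> A mA.
under eq_integral do rewrite -GE.
rewrite [RHS](IH (J :\ b)%SET (fun b' => if b' == b then \1_A else f b')
  (fun b' => if b' == b then fine (nu b A) else c b')).
- rewrite [in RHS](bigD1 b)//= eqxx mulrC EFinM fineK ?fin_num_measure//.
  rewrite /mscale/= /C; congr (_%:E * _)%E.
  by apply: eq_bigr => b' /negPf->.
- by move: cJ; rewrite (cardsD1 b) bJ => -[].
- move=> b'; case: eqP => [_ _|/eqP bb]; first by exists A.
  by rewrite !inE bb /= => /fJ.
- by move=> b'; case: eqP => // _; exact: measurable_indic.
- by move=> b' x; case: eqP.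
- move=> b'; case: eqP => // ->; rewrite integral_indic// setIT fineK//.
  exact: fin_num_measure.
Qed.

(** By multilinearity: a factor of unknown sign is the difference of its positive and negative
    parts, and the induction runs on the number of such factors. Integrability of the product is
    carried along because the integral of a difference needs it. *)
Lemma expectation_prod (f : B -> S -> R) (c : B -> R) :
  (forall b, (nu b).-integrable setT (fun x => (f b x)%:E)) ->
  (forall b, \int[nu b]_x (f b x)%:E = (c b)%:E)%E ->
  P.-integrable setT (fun t => (\prod_b f b (X b t))%:E) /\
  (\int[P]_t (\prod_b f b (X b t))%:E = (\prod_b c b)%:E)%E.
Proof.
suff H n : forall (J : {set B}) (f : B -> S -> R) (c : B -> R), #|J| = n ->
  (forall b, b \notin J -> forall x, 0 <= f b x) ->
  (forall b, (nu b).-integrable setT (fun x => (f b x)%:E)) ->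
  (forall b, \int[nu b]_x (f b x)%:E = (c b)%:E)%E ->
  P.-integrable setT (fun t => (\prod_b f b (X b t))%:E) /\
  (\int[P]_t (\prod_b f b (X b t))%:E = (\prod_b c b)%:E)%E.
  move=> fi fc; apply: (H #|[set: B]|%SET [set: B]%SET) => // b.
  by rewrite inE.
elim: n => [|n IH] J {}f {}c cJ fJ fi fc.
  move/eqP: cJ; rewrite cards_eq0 => /eqP J0.
  have f0 b x : 0 <= f b x by apply: fJ; rewrite J0 inE.
  have mf b : measurable_fun setT (f b).
    by apply/measurable_EFinP; have /integrableP[] := fi b.
  have E := ge0_expectation_prod mf f0 fc; split => //.
  apply/integrableP; split.
    by apply/measurable_EFinP; exact: measurable_prod_comp.
  rewrite (eq_integral (fun t => (\prod_b f b (X b t))%:E)) ?E ?ltry//.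
  by move=> t _; rewrite gee0_abs// lee_fin prodr_ge0.
have [b bJ] : exists b, b \in J by apply/set0Pn; rewrite -card_gt0 cJ.
pose fp (s : bool) x := Num.max (if s then f b x else - f b x) 0.
have fpE x : f b x = fp true x - fp false x.
  by rewrite /fp /=; case: (leP (f b x) 0); case: (leP (- f b x) 0); lra.
have ifp s : (nu b).-integrable setT (fun x => (fp s x)%:E).
  have := fi b => /integrableP[/measurable_EFinP mf _].
  apply: le_integrable (fi b) => //.
    apply/measurable_EFinP; apply: measurable_maxr => //.
    by case: s => //; exact: measurable_funN.
  move=> x _; rewrite !abse_EFin lee_fin /fp.
  rewrite ger0_norm ?le_max ?lexx ?orbT// ge_max normr_ge0 andbT.
  by case: s; rewrite ?ler_norm// -normrN ler_norm.
pose cp s := fine (\int[nu b]_x (fp s x)%:E).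
have cpE : c b = cp true - cp false.
  apply: EFin_inj; rewrite -fc EFinB !fineK ?integrable_fin_num//.
  rewrite -integralB//; apply: eq_integral => x _.
  by rewrite -EFinB -fpE.
have K s := IH (J :\ b)%SET (fun b' => if b' == b then fp s else f b')
  (fun b' => if b' == b then cp s else c b').
have {K} K s : P.-integrable setT
    (fun t => (\prod_b' (if b' == b then fp s else f b') (X b' t))%:E) /\
  (\int[P]_t (\prod_b' (if b' == b then fp s else f b') (X b' t))%:E =
   (\prod_b' if b' == b then cp s else c b')%:E)%E.
  apply: K.
  - by move: cJ; rewrite (cardsD1 b) bJ => -[].
  - move=> b'; case: eqP => [_ _ x|/eqP bb]; first by rewrite le_max lexx orbT.
    by rewrite !inE bb /= => /fJ.
  - by move=> b'; case: eqP => // ->.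
  - move=> b'; case: eqP => // ->; rewrite fineK//.
    exact: integrable_fin_num.
have -> : (fun t => (\prod_b f b (X b t))%:E) =
  (fun t => (\prod_b' (if b' == b then fp true else f b') (X b' t))%:E -
    (\prod_b' (if b' == b then fp false else f b') (X b' t))%:E)%E.
  apply/funext => t; rewrite -EFinB; congr EFin.
  rewrite (bigD1 b)//= [in RHS](bigD1 b)//= [X in _ = _ - X](bigD1 b)//=.
  rewrite !eqxx fpE mulrBl; congr (_ * _ - _ * _);
  by apply: eq_bigr => b' /negPf->.
have [i1 e1] := K true; have [i2 e2] := K false.
split; first exact: integrableB.
rewrite integralB// e1 e2 -EFinB; congr EFin.
rewrite [RHS](bigD1 b)//= (bigD1 b)//= [X in _ - X = _](bigD1 b)//=.
rewrite !eqxx cpE mulrBl; congr (_ * _ - _ * _);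
by apply: eq_bigr => b' /negPf->.
Qed.

End independent_products.

(** * Gaussian moments *)

Section integral_of_derivative.
Context (R : realType).
Notation mu := (@lebesgue_measure R).

(** The fundamental theorem of calculus on [[-n, n]], and dominated convergence with [|f|] as
    dominating function; this is why limits of [F] along the integers suffice. *)
Lemma integral_derivative_eq0 (f F : R -> R) : continuous f ->
  (forall x : R, is_derive x 1 F (f x)) ->
  mu.-integrable setT (fun x => (f x)%:E) ->
  F n%:R @[n --> \oo] --> (0 : R) -> F (- n%:R) @[n --> \oo] --> (0 : R) ->
  (\int[mu]_x (f x)%:E = 0)%E.
Proof.
move=> cf dF fi F1 F2.
have cF : continuous F.
  move=> x; apply: differentiable_continuous; apply/derivable1_diffP.
  by have [] := dF x.
pose I (n : nat) : set R := `[- n%:R, n%:R]%classic.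
pose f_ (n : nat) := (EFin \o f) \_ (I n).
have mI n : measurable (I n) by exact: measurable_itv.
have mf : measurable_fun setT (EFin \o f).
  by apply/measurable_EFinP; exact: continuous_measurable_fun.
have mf_ n : measurable_fun setT (f_ n).
  by apply/(measurable_restrictT _ (mI n)); exact: measurable_funTS.
have [] := @dominated_convergence _ _ R mu setT measurableT f_
  (EFin \o f) (fun x => `|(f x)%:E|%E) mf_ mf.
- apply: aeW => x _; apply: cvg_near_cst; near=> n.
  rewrite /f_ patchE mem_set//= /I/= in_itv /=.
  by rewrite -ler_norml; near: n; exact: nbhs_infty_ger.
- exact: integrable_abse.
- apply: aeW => x n _; rewrite /f_ patchE; case: ifP => //= _.
  by rewrite normr0 lee_fin.
move=> _ _ h.
(* Shifted by one, because the fundamental theorem needs a non-degenerate interval. *)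
have e n : (\int[mu]_x f_ n.+1 x = (F n.+1%:R - F (- n.+1%:R))%:E)%E.
  rewrite EFinB -(@continuous_FTC2 _ f F)//.
  - by rewrite [RHS]integral_mkcond.
  - by rewrite gtrN ?ltr0n.
  - exact: continuous_subspaceT.
  - split; [by move=> x _; have [] := dF x| |].
      exact/cvg_at_right_filter/cF.
    exact/cvg_at_left_filter/cF.
  - by move=> x _; rewrite derive1E; have [_ ->] := dF x.
have h2 : (\int[mu]_x f_ n.+1 x @[n --> \oo] --> (0 : R)%:E)%E.
  under eq_fun do rewrite e.
  apply: cvg_EFin; first by near=> n.
  rewrite -[X in _ --> X](subr0 0); apply: cvgB.
    by rewrite (@cvg_shiftS _ (fun n => F n%:R)).
  by rewrite (@cvg_shiftS _ (fun n => F (- n%:R))).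
apply: (cvg_unique _ _ h2) => //.
by rewrite /= (@cvg_shiftS _ (fun n => \int[mu]_x f_ n x)%E).
Unshelve. all: by end_near. Qed.

End integral_of_derivative.

Section normal_moments.
Context (R : realType) (s : R).
Hypothesis s0 : s != 0.
Notation mu := (@lebesgue_measure R).
Let p := normal_pdf 0 s.

Let pE x : p x = normal_peak s * expR (- x ^+ 2 / (s ^+ 2 *+ 2)).
Proof. by rewrite /p normal_pdfE// /normal_fun subr0. Qed.

(** Doubling the standard deviation leaves room to absorb any power of [x]. This one bound gives
    both the integrability of the moments and the vanishing of the boundary terms at infinity. *)
Lemma normal_pdf_pow_bound m : exists2 C, 0 <= C &
  forall x, `|x ^+ m * normal_pdf 0 s x| <= C * normal_pdf 0 (2 * s) x.
Proof.
have s20 : 0 < s ^+ 2 by rewrite exprn_even_gt0.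
have ss0 : 2 * s != 0 by rewrite mulf_neq0.
(* With [v = x ^ 2 / (8 s ^ 2)] the two exponentials are [expR (- 4 v)] and [expR (- v)]. From
   [v ^ m <= m! expR v] comes [x ^ (2 m) <= K expR v], and [|x| ^ m] is at most 1 or at most
   [x ^ (2 m)]. *)
pose K := (8 * s ^+ 2) ^+ m * m`!%:R.
have K0 : 0 <= K by rewrite mulr_ge0// exprn_ge0// mulr_ge0// ltW.
have A0 : 0 < normal_peak (2 * s) by rewrite normal_peak_gt0.
have B0 : 0 < normal_peak s by rewrite normal_peak_gt0.
exists (normal_peak s * (1 + K) / normal_peak (2 * s)).
  by rewrite !mulr_ge0 ?invr_ge0 ?addr_ge0 ?(ltW B0) ?(ltW A0).
move=> x; rewrite !normal_pdfE// /normal_fun subr0.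
pose v := x ^+ 2 / (8 * s ^+ 2).
have v0 : 0 <= v by rewrite divr_ge0 ?sqr_ge0// mulr_ge0// ltW.
have -> : - x ^+ 2 / (s ^+ 2 *+ 2) = - (4 * v).
  by rewrite /v; field; rewrite s0.
have -> : - x ^+ 2 / ((2 * s) ^+ 2 *+ 2) = - v.
  by rewrite /v; field; rewrite s0.
rewrite [leRHS]mulrA divfK ?gt_eqF// normrM normrX.
rewrite [`|normal_peak s * _|]ger0_norm ?mulr_ge0 ?expR_ge0 ?(ltW B0)//.
rewrite mulrCA -[leRHS]mulrA ler_wpM2l ?(ltW B0)//.
have h1 : `|x| ^+ m <= 1 + K * expR v.
  have h2 : (x ^+ 2) ^+ m <= K * expR v.
    have -> : x ^+ 2 = 8 * s ^+ 2 * v.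
      by rewrite /v; field; rewrite s0.
    rewrite exprMn /K -mulrA ler_wpM2l//.
      by rewrite exprn_ge0// mulr_ge0// ltW.
    rewrite -ler_pdivrMl ?ltr0n ?fact_gt0// mulrC.
    case: m {K K0} => [|m].
      by rewrite expr0 fact0 divr1 -expR0 ler_expR.
    by apply: le_trans (expR_ge1Dxn m v0); rewrite lerDr.
  have [x1|x1] := leP `|x| 1.
    apply: (@le_trans _ _ 1); first by rewrite exprn_ile1.
    by rewrite lerDl mulr_ge0 ?expR_ge0.
  apply: (le_trans _ (le_trans h2 _)); last by rewrite lerDr.
  rewrite -real_normK ?num_real// -exprM ler_weXn2l ?(ltW x1)//.
  by rewrite leq_pmull.
apply: (le_trans (ler_wpM2r (expR_ge0 _) h1)).
have e1 : expR (- (4 * v)) <= expR (- v) by rewrite ler_expR; lra.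
have e2 : expR v * expR (- (4 * v)) <= expR (- v).
  by rewrite -expRD ler_expR; lra.
rewrite [leLHS]mulrDl [leRHS]mulrDl !mul1r; apply: lerD => //.
by rewrite -[leLHS]mulrA; apply: ler_wpM2l.
Qed.

Lemma integrable_normal_pdf_pow m :
  mu.-integrable setT (fun x => (x ^+ m * normal_pdf 0 s x)%:E).
Proof.
have [C C0 hC] := normal_pdf_pow_bound m.
apply: (@le_integrable _ _ _ mu setT _ _
  (fun x => C%:E * (normal_pdf 0 (2 * s) x)%:E)%E) => //.
- apply/measurable_EFinP; apply: measurable_funM.
    exact: measurable_funX.
  exact: measurable_normal_pdf.
- move=> x _; rewrite -EFinM !abse_EFin lee_fin (le_trans (hC x))//.
  exact: ler_norm.
- apply: integrableZl => //; exact: integrable_normal_pdf.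
Qed.

Let cvg0 m (e : nat -> R) : (forall n, `|e n| = n%:R) ->
  e n ^+ m * p (e n) @[n --> \oo] --> (0 : R).
Proof.
(* The bound is taken at exponent [m.+1]: the extra factor [|e n| = n] turns boundedness into decay
   of order [1 / n]. *)
move=> he; have [C C0 hC] := normal_pdf_pow_bound m.+1.
have ss0 : 2 * s != 0 by rewrite mulf_neq0.
apply/norm_cvg0P; apply: (@squeeze_cvgr _ _ _ _ (fun=> 0)
  (fun n => C * normal_peak (2 * s) * n%:R^-1)); last 2 first.
- exact: cvg_cst.
- rewrite -[X in _ --> X](mulr0 (C * normal_peak (2 * s))).
  apply: cvgM; first exact: cvg_cst.
  apply/gtr0_cvgV0; last exact: cvgr_idn.
  by near=> n; rewrite ltr0n; near: n; exact: nbhs_infty_gt.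
near=> n; rewrite normr_ge0 /=.
have n0 : 0 < n%:R :> R by rewrite ltr0n; near: n; exact: nbhs_infty_gt.
rewrite ler_pdivlMr// -he -normrM mulrAC -exprSr.
apply: (le_trans (hC _)); rewrite ler_wpM2l//.
exact: normal_pdf_ub.
Unshelve. all: by end_near. Qed.

(** The integrand is the derivative of [x ^+ m * normal_pdf 0 s x], as the density has logarithmic
    derivative [- x / s ^ 2]. At [m = 0] the truncated exponent is harmless because its coefficient
    is zero. *)
Lemma integral_normal_pdf_pow_rec m :
  (\int[mu]_x (m%:R * x ^+ m.-1 * normal_pdf 0 s x -
     (s ^+ 2)^-1 * (x ^+ m.+1 * normal_pdf 0 s x))%:E = 0)%E.
Proof.
have s20 : 0 < s ^+ 2 by rewrite exprn_even_gt0.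
apply: (@integral_derivative_eq0 _ _ (fun x => x ^+ m * p x)).
- have cX k : continuous (fun x : R => x ^+ k).
    by move=> x; exact: exprn_continuous.
  have cp : continuous (normal_pdf 0 s) by exact: continuous_normal_pdf.
  move=> x; apply: cvgB; apply: cvgM; try exact: cvg_cst; try exact: cp.
    by apply: cvgM; [exact: cvg_cst|exact: cX].
  by apply: cvgM; [exact: cX|exact: cp].
- move=> x.
  have -> : (fun x => x ^+ m * p x) = (id ^+ m : R -> R) *
      (normal_peak s \*:
        (expR \o ((- (s ^+ 2 *+ 2)^-1) \*: (id ^+ 2 : R -> R)))).
    apply/funext => y /=; rewrite pE !fctE /=.
    by congr (_ * (_ * expR _)); rewrite [RHS]mulrC; ring.
  apply: is_derive_eq => /=.
  rewrite -/p pE !fctE /= /GRing.scale /=.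
  have -> : - (s ^+ 2 *+ 2)^-1 * x ^+ 2 = - x ^+ 2 / (s ^+ 2 *+ 2) by ring.
  set e := expR _; rewrite [x ^+ m.+1]exprS expr1 !mulr1.
  have -> : (s ^+ 2 *+ 2)^-1 = (s ^+ 2)^-1 / 2 by field; rewrite s0.
  by field; rewrite s0.
- have i1 := integrable_normal_pdf_pow m.-1.
  have i2 := integrable_normal_pdf_pow m.+1.
  under eq_fun do rewrite -mulrA EFinB !(EFinM _ (_ * _)).
  by apply: integrableB => //; exact: integrableZl.
- by apply: cvg0 => n; rewrite normr_nat.
- by apply: cvg0 => n; rewrite normrN normr_nat.
Qed.

End normal_moments.

Section gaussian_moments.
Context (R : realType).
Notation mu := (@lebesgue_measure R).

Definition gauss_law (s : R) : probability (measurableTypeR R) R :=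
  if s == 0 then (\d_(0 : measurableTypeR R) : probability _ R)
  else (normal_prob 0 s : probability _ R).

Lemma gauss_lawE s A : gauss_law s A = gauss s A.
Proof. by rewrite /gauss_law /gauss; case: ifP. Qed.

(** Moments of the centered normal law: zero in odd degree, [(2 k - 1)!! s ^ (2 k)] in degree [2 k].
    At [s = 0] they are the moments of the Dirac mass at zero, so both cases of [gauss] are
    covered. *)
Fixpoint gauss_moment (s : R) (m : nat) : R :=
  match m with
  | 0 => 1
  | m'.+1 => if m' is m''.+1 then m'%:R * s ^+ 2 * gauss_moment s m'' else 0
  end.

Lemma gauss_momentS s m :
  gauss_moment s m.+1 = m%:R * s ^+ 2 * gauss_moment s m.-1.
Proof. by case: m => //=; rewrite !mul0r. Qed.

Lemma gauss_law_moment s m :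
  (gauss_law s).-integrable setT (fun x : R => (x ^+ m)%:E) /\
  (\int[gauss_law s]_x (x ^+ m)%:E = (gauss_moment s m)%:E)%E.
Proof.
have mX k : measurable_fun setT (fun x : measurableTypeR R => (x : R) ^+ k).
  exact: exprn_measurable.
rewrite /gauss_law; case: eqP => [->|/eqP s0].
  have mE :
      measurable_fun setT (fun x : measurableTypeR R => ((x : R) ^+ m)%:E).
    exact/measurable_EFinP.
  split.
    apply/integrableP; split=> //.
    rewrite integral_dirac//; last exact: measurableT_comp.
    by rewrite diracT mul1e ltry.
  rewrite integral_dirac// diracT mul1e; congr EFin.
  case: m {mE} => [|m]; first by rewrite expr0.
  by rewrite gauss_momentS !expr0n/= mulr0 mul0r.
have s20 : s ^+ 2 != 0 by rewrite expf_neq0.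
pose J k := fine (\int[mu]_x (x ^+ k * normal_pdf 0 s x)%:E).
have JE k : (\int[mu]_x (x ^+ k * normal_pdf 0 s x)%:E = (J k)%:E)%E.
  rewrite fineK// integrable_fin_num//.
  exact: integrable_normal_pdf_pow.
have J0 : J 0 = 1.
  apply: EFin_inj; rewrite -JE -(integral_normal_pdf 0 s).
  by apply: eq_integral => x _; rewrite mul1r.
have JS k : J k.+1 = k%:R * s ^+ 2 * J k.-1.
  have := integral_normal_pdf_pow_rec s0 k.
  under eq_integral do rewrite -mulrA EFinB !(EFinM _ (_ * _)).
  rewrite integralB//; last 2 first.
  - by apply: integrableZl => //; exact: integrable_normal_pdf_pow.
  - by apply: integrableZl => //; exact: integrable_normal_pdf_pow.
  rewrite !integralZl//; try exact: integrable_normal_pdf_pow.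
  rewrite !JE -!EFinM -EFinB => -[/eqP]; rewrite subr_eq0 => /eqP e.
  by rewrite mulrAC e; field.
have JM k : J k = gauss_moment s k.
  have [n kn] := ubnP k; elim: n k kn => // n IH [|k] kn; first by rewrite J0.
  rewrite JS gauss_momentS IH//; apply: leq_ltn_trans (leq_pred _) _.
  by rewrite -ltnS.
have [] := @integral_density _ _ _ _ R id (@measurable_id _ _ _) mu
  (normal_prob 0 s) (normal_pdf 0 s) _ _ _ (fun x => x ^+ m) _ _ => //.
- exact: normal_pdf_ge0.
- exact: measurable_normal_pdf.
- move=> A mA; rewrite /normal_prob [LHS]integral_mkcond.
  apply: eq_integral => x _.
  by rewrite patchE indicE; case: ifP; rewrite ?mulr1 ?mulr0.
- under eq_fun do rewrite mulrC; exact: integrable_normal_pdf_pow.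
- move=> i1 ->; split => //.
  under eq_integral do rewrite mulrC.
  by rewrite JE JM.
Qed.

End gaussian_moments.

(** * Gaussian integration by parts *)

Section complex_expectation.
Context d (T : measurableType d) (R : realType) (P : probability T R).

Definition cintegrable (Z : T -> R[i]) : Prop :=
  P.-integrable setT (fun t => (complex.Re (Z t))%:E) /\
  P.-integrable setT (fun t => (complex.Im (Z t))%:E).

Lemma cexpectE (Z : T -> R[i]) : cexpect P Z =
  fine (\int[P]_t (complex.Re (Z t))%:E) +i*
  fine (\int[P]_t (complex.Im (Z t))%:E).
Proof. by rewrite /cexpect !unlock. Qed.

Lemma cintegrableD Z W : cintegrable Z -> cintegrable W ->
  cintegrable (fun t => Z t + W t).
Proof.
move=> [z1 z2] [w1 w2]; split.
  rewrite (_ : (fun t => _) =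
    (fun t => (complex.Re (Z t))%:E + (complex.Re (W t))%:E)%E).
    exact: integrableD.
  by apply/funext => t; case: (Z t) (W t) => ? ? [].
rewrite (_ : (fun t => _) =
    (fun t => (complex.Im (Z t))%:E + (complex.Im (W t))%:E)%E).
  exact: integrableD.
by apply/funext => t; case: (Z t) (W t) => ? ? [].
Qed.

Lemma cexpectD Z W : cintegrable Z -> cintegrable W ->
  cexpect P (fun t => Z t + W t) = cexpect P Z + cexpect P W.
Proof.
move=> [z1 z2] [w1 w2]; rewrite !cexpectE.
have E1 t : (complex.Re (Z t + W t))%:E =
    ((complex.Re (Z t))%:E + (complex.Re (W t))%:E)%E.
  by case: (Z t) (W t) => ? ? [].
have E2 t : (complex.Im (Z t + W t))%:E =
    ((complex.Im (Z t))%:E + (complex.Im (W t))%:E)%E.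
  by case: (Z t) (W t) => ? ? [].
under eq_integral do rewrite E1.
under [X in _ +i* fine X = _]eq_integral do rewrite E2.
rewrite !integralD//; apply/eqP; rewrite eq_complex/=.
by apply/andP; split; apply/eqP; apply: fineD; exact: integrable_fin_num.
Qed.

Lemma cintegrableZ c Z : cintegrable Z -> cintegrable (fun t => c * Z t).
Proof.
case: c => a b [z1 z2]; split.
  rewrite (_ : (fun t => _) = (fun t => a%:E * (complex.Re (Z t))%:E -
      b%:E * (complex.Im (Z t))%:E)%E).
    by apply: integrableB => //; exact: integrableZl.
  by apply/funext => t; case: (Z t).
rewrite (_ : (fun t => _) = (fun t => a%:E * (complex.Im (Z t))%:E +
      b%:E * (complex.Re (Z t))%:E)%E).
  by apply: integrableD => //; exact: integrableZl.
by apply/funext => t; case: (Z t).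
Qed.

Lemma cexpectZ c Z : cintegrable Z ->
  cexpect P (fun t => c * Z t) = c * cexpect P Z.
Proof.
case: c => a b [z1 z2]; rewrite !cexpectE.
have E1 t : (complex.Re ((a +i* b) * Z t))%:E =
    (a%:E * (complex.Re (Z t))%:E - b%:E * (complex.Im (Z t))%:E)%E.
  by case: (Z t).
have E2 t : (complex.Im ((a +i* b) * Z t))%:E =
    (a%:E * (complex.Im (Z t))%:E + b%:E * (complex.Re (Z t))%:E)%E.
  by case: (Z t).
under eq_integral do rewrite E1.
under [X in _ +i* fine X = _]eq_integral do rewrite E2.
have iz c : P.-integrable setT (fun t => c%:E * (complex.Re (Z t))%:E)%E.
  exact: integrableZl.
have iw c : P.-integrable setT (fun t => c%:E * (complex.Im (Z t))%:E)%E.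
  exact: integrableZl.
rewrite integralB// integralD//; apply/eqP; rewrite eq_complex/=.
have fz c : (\int[P]_t (c%:E * (complex.Re (Z t))%:E))%E \is a fin_num.
  exact: integrable_fin_num.
have fw c : (\int[P]_t (c%:E * (complex.Im (Z t))%:E))%E \is a fin_num.
  exact: integrable_fin_num.
have ez c : fine (\int[P]_t (c%:E * (complex.Re (Z t))%:E))%E =
    c * fine (\int[P]_t (complex.Re (Z t))%:E)%E.
  by rewrite integralZl// fineM//; exact: integrable_fin_num.
have ew c : fine (\int[P]_t (c%:E * (complex.Im (Z t))%:E))%E =
    c * fine (\int[P]_t (complex.Im (Z t))%:E)%E.
  by rewrite integralZl// fineM//; exact: integrable_fin_num.
by rewrite (fineB (fz _) (fw _)) (fineD (fw _) (fz _)) !ez !ew !eqxx.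
Qed.

Lemma cintegrable_real (X : T -> R) :
  P.-integrable setT (fun t => (X t)%:E) -> cintegrable (fun t => (X t)%:C).
Proof. by move=> iX; split => //; exact: integrable0. Qed.

Lemma cexpect_real (X : T -> R) :
  cexpect P (fun t => (X t)%:C) = (fine (\int[P]_t (X t)%:E))%:C.
Proof. by rewrite cexpectE/= integral0. Qed.

End complex_expectation.

(** * Stein's identity for polynomials in independent normal variables *)

Section gaussian_polynomials.
Context d (T : measurableType d) (R : realType) (P : probability T R).
Variables (N : nat) (X : 'I_N -> T -> R) (s : 'I_N -> R).
Hypothesis mX : forall b, measurable_fun setT (X b : T -> measurableTypeR R).
Hypothesis indep : forall A : 'I_N -> set (measurableTypeR R),
  (forall b, measurable (A b)) ->
  P [set t | forall b, A b (X b t)] = (\prod_b gauss_law (s b) (A b))%E.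

Local Notation A := (mpoly.mpoly N R[i]).

Definition poly_eval (t : T) : A -> R[i] :=
  mpoly.meval (fun b => (X b t)%:C).

Lemma gaussian_monomial (m : 'I_N -> nat) :
  P.-integrable setT (fun t => (\prod_b X b t ^+ m b)%:E) /\
  (\int[P]_t (\prod_b X b t ^+ m b)%:E =
   (\prod_b gauss_moment (s b) (m b))%:E)%E.
Proof.
exact: (@expectation_prod _ _ T (measurableTypeR R) R P 'I_N X mX
  (fun b => gauss_law (s b)) indep (fun b x => x ^+ m b)
  (fun b => gauss_moment (s b) (m b))
  (fun b => (gauss_law_moment (s b) (m b)).1)
  (fun b => (gauss_law_moment (s b) (m b)).2)).
Qed.

Lemma poly_eval_monomial t m :
  poly_eval t (mpoly.mpolyX _ m) = (\prod_b X b t ^+ m b)%:C.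
Proof.
rewrite /poly_eval mpoly.mevalX rmorph_prod /=.
by apply: eq_bigr => b _; rewrite rmorphXn.
Qed.

Lemma poly_eval_integrable f : cintegrable P (fun t => poly_eval t f).
Proof.
elim/mpoly.mpolyind: f => [|c m p _ _ IH].
  rewrite (_ : (fun t => _) = (fun t => 0%:C)).
    by apply: cintegrable_real; exact: integrable0.
  by apply/funext => t; rewrite /poly_eval mpoly.meval0.
rewrite (_ : (fun t => _) =
  (fun t => c * poly_eval t (mpoly.mpolyX _ m) + poly_eval t p)).
  apply: cintegrableD => //; apply: cintegrableZ.
  under eq_fun do rewrite poly_eval_monomial.
  by apply: cintegrable_real; exact: (gaussian_monomial m).1.
by apply/funext => t; rewrite /poly_eval mpoly.mevalD mpoly.mevalZ.
Qed.

Definition poly_expect (f : A) : R[i] :=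
  cexpect P (fun t => poly_eval t f).

Lemma poly_expectD (f g : A) :
  poly_expect (f + g) = poly_expect f + poly_expect g.
Proof.
rewrite /poly_expect -cexpectD; try exact: poly_eval_integrable.
by congr cexpect; apply/funext => t; rewrite /poly_eval mpoly.mevalD.
Qed.

Lemma poly_expectZ c (f : A) : poly_expect (c *: f) = c * poly_expect f.
Proof.
rewrite /poly_expect -cexpectZ; last exact: poly_eval_integrable.
by congr cexpect; apply/funext => t; rewrite /poly_eval mpoly.mevalZ.
Qed.

Lemma poly_expect_monomial m : poly_expect (mpoly.mpolyX _ m) =
  (\prod_b gauss_moment (s b) (m b))%:C.
Proof.
rewrite /poly_expect; under eq_fun do rewrite poly_eval_monomial.
by rewrite cexpect_real (gaussian_monomial m).2.
Qed.

(** By linearity monomials suffice. There the expectation is a product of one-variable moments, of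
    which only the one at [b] changes, by the recursion [gauss_momentS]. *)
Lemma poly_expect_stein b (f : A) :
  poly_expect (mpoly.mpolyX _ (mpoly.mnm1 b) * f) =
  (s b ^+ 2)%:C * poly_expect (mpoly.mderiv b f).
Proof.
elim/mpoly.mpolyind: f => [|c m p _ _ IH].
  have E0 : poly_expect 0 = 0.
    by rewrite -(scale0r 0) poly_expectZ mul0r.
  by rewrite mpoly.mderiv0 mulr0 E0 mulr0.
rewrite mulrDr poly_expectD IH mpoly.mderivD poly_expectD mulrDr.
congr (_ + _); rewrite -scalerAr -mpoly.mpolyXD poly_expectZ.
rewrite mpoly.mderivZ poly_expectZ mulrCA; congr (_ * _).
rewrite mpoly.mderivX poly_expectZ !poly_expect_monomial.
rewrite [in LHS](bigD1 b)//= [in RHS](bigD1 b)//=.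
rewrite mpoly.mnmDE mpoly.mnmBE mpoly.mnm1E eqxx add1n subn1.
rewrite gauss_momentS.
have -> : \prod_(i | i != b) gauss_moment (s i)
      (mpoly.mnm_add (mpoly.mnm1 b) m i) =
    \prod_(i | i != b) gauss_moment (s i) (m i).
  apply: eq_bigr => i ib.
  by rewrite mpoly.mnmDE mpoly.mnm1E eq_sym (negPf ib).
have -> : \prod_(i | i != b) gauss_moment (s i)
      (mpoly.mnm_sub m (mpoly.mnm1 b) i) =
    \prod_(i | i != b) gauss_moment (s i) (m i).
  apply: eq_bigr => i ib.
  by rewrite mpoly.mnmBE mpoly.mnm1E eq_sym (negPf ib) subn0.
by rewrite !rmorphM rmorph_nat /=; ring.
Qed.

End gaussian_polynomials.

(** The part of complex Gaussian calculus that the loop equations use. The flag [true] means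
    conjugation of the generator. [wick_der a false] is the Wirtinger derivative in the conjugate of
    the variable [a], and [wick_der a true] the one in the variable itself: a variable pairs only
    with its own conjugate. *)
Record wick_calculus d (T : measurableType d) (R : realType)
    (P : probability T R) (I : finType) (Z : I -> T -> R[i]) (v : I -> R) :=
  WickCalculus {
  wick_ring : comNzRingType;
  wick_eval : T -> {rmorphism wick_ring -> R[i]};
  wick_expect : {additive wick_ring -> R[i]};
  wick_gen : I -> bool -> wick_ring;
  wick_der : I -> bool -> {additive wick_ring -> wick_ring};
  wick_expectE : forall f, wick_expect f = cexpect P (fun t => wick_eval t f);
  wick_eval_gen : forall a e t,
    wick_eval t (wick_gen a e) = if e then (Z a t)^* else Z a t;
  wick_derM : forall a e f g, wick_der a e (f * g) =
    wick_der a e f * g + f * wick_der a e g;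
  wick_der_gen : forall a e a' e', wick_der a e (wick_gen a' e') =
    ((a == a') && (e != e'))%:R;
  wick_by_parts : forall a e f, wick_expect (wick_gen a e * f) =
    (v a)%:C * wick_expect (wick_der a e f) }.

(** The ring consists of polynomials in the real and imaginary parts, to which Stein's identity
    applies: independence across indices, together with independence of the two parts of each
    variable, makes all these real variables independent. *)
Lemma gaussian_wick d (T : measurableType d) (R : realType)
    (P : probability T R) (I : finType) (Z : I -> T -> R[i]) (v : I -> R) :
  mutually_independent P Z -> (forall a, circular_gaussian P (Z a)) ->
  (forall a, 'E_P[fun t => cabs2 (Z a t)]%E = (v a)%:E) ->
  inhabited (wick_calculus P Z v).
Proof.
move=> Zindep Zgauss Zvar.
have /choice[s hs] : forall a, exists s : R,
    forall A B : set (measurableTypeR R), measurable A -> measurable B ->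
          P [set t | A (complex.Re (Z a t)) /\ B (complex.Im (Z a t))] =
          (gauss s A * gauss s B)%E.
  by move=> a; have [_ _ [s _ h]] := Zgauss a; exists s.
pose J : finType := (I * bool)%type.
pose X (j : 'I_#|J|) t := let b := enum_val j in
  if b.2 then complex.Im (Z b.1 t) else complex.Re (Z b.1 t).
pose sg (j : 'I_#|J|) := s (enum_val j).1.
have mX b : measurable_fun setT (X b : T -> measurableTypeR R).
  rewrite /X; have [mR mI _] := Zgauss (enum_val b).1.
  by case: ((enum_val b).2).
have Xindep (A : 'I_#|J| -> set (measurableTypeR R)) :
    (forall b, measurable (A b)) ->
    P [set t | forall b, A b (X b t)] = (\prod_b gauss_law (sg b) (A b))%E.
  (* A rectangle in each complex plane: independence of the complex variables then tests all the
     real variables at once. *)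
  move=> mA; pose A' a := A (enum_rank (a, false)) `*` A (enum_rank (a, true)).
  have := Zindep [set: I]%SET A' (fun a => measurableX (mA _) (mA _)).
  have -> : [set t | forall i, i \in [set: I]%SET ->
      A' i (complex.Re (Z i t), complex.Im (Z i t))] =
      [set t | forall b, A b (X b t)].
    apply/seteqP; split => t /= h => [b|i _].
      have [h1 h2] := h (enum_val b).1 (finset.in_setT _).
      case E : (enum_val b) h1 h2 => [a c] /= h1 h2.
      have bE : b = enum_rank (a, c) by rewrite -E enum_valK.
      by rewrite /X E /=; case: c bE {E} => ->.
    have := h (enum_rank (i, false)); have := h (enum_rank (i, true)).
    by rewrite /X !enum_rankK.
  move=> ->.
  rewrite (reindex (@enum_rank J))/=; last first.
    by apply: onW_bij; exact: enum_rank_bij.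
  rewrite (eq_bigl predT); last by move=> i; rewrite inE.
  rewrite [RHS](eq_bigr
      (fun j => gauss_law (s j.1) (A (enum_rank (j.1, j.2)))));
    last by move=> [a c] _; rewrite /sg enum_rankK.
  rewrite -(pair_bigA _ (fun a c => gauss_law (s a) (A (enum_rank (a, c)))))/=.
  apply: eq_bigr => a _; rewrite big_bool /= !gauss_lawE muleC.
  by rewrite -hs.
pose A : comNzRingType := mpoly.mpoly #|J| R[i].
pose ev t : {rmorphism A -> R[i]} := mpoly.meval (fun b => (X b t)%:C).
have phiD : zmod_morphism (poly_expect P X : A -> R[i]).
  move=> f g; rewrite -scaleN1r (poly_expectD mX Xindep).
  by rewrite (poly_expectZ mX Xindep) mulN1r.
pose phi : {additive A -> R[i]} :=
  HB.pack (poly_expect P X : A -> R[i]) (GRing.isZmodMorphism.Build _ _ _ phiD).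
(* This sign makes [z a e] equal to x + iy or x - iy, and [D a e] the Wirtinger derivative in the
   conjugate of that same variable. *)
pose sgn (e : bool) : R[i] := if e then - 'i else 'i.
pose x a c : A := mpoly.mpolyX _ (mpoly.mnm1 (enum_rank (a, c) : 'I_#|J|)).
pose z a e : A := x a false + sgn e *: x a true.
pose D a e (f : A) : A :=
  2^-1 *: (mpoly.mderiv (enum_rank (a, false)) f +
           sgn e *: mpoly.mderiv (enum_rank (a, true)) f).
have DD a e : zmod_morphism (D a e).
  move=> f g; rewrite /D !mpoly.mderivB -scalerBr; congr (_ *: _).
  by rewrite scalerBr opprD addrACA.
pose D' a e : {additive A -> A} :=
  HB.pack (D a e) (GRing.isZmodMorphism.Build _ _ _ (DD a e)).
have sii : 'i * 'i = -1 :> R[i].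
  by apply/eqP; rewrite eq_complex/=; apply/andP; split; apply/eqP; ring.
(* Real and imaginary parts have variance [s a ^+ 2] each; the resulting 2 cancels the [2^-1] in
   [D]. *)
have vE a : v a = 2 * s a ^+ 2.
  have sq c : P.-integrable setT
        (fun t => (X (enum_rank (a, c)) t ^+ 2)%:E) /\
      (\int[P]_t (X (enum_rank (a, c)) t ^+ 2)%:E = (s a ^+ 2)%:E)%E.
    set j := enum_rank (a, c).
    pose m (b : 'I_#|J|) : nat := if b == j then 2 else 0.
    have E (F : 'I_#|J| -> nat -> R) : (forall b, F b 0 = 1) ->
        \prod_b F b (m b) = F j 2.
      move=> F0; rewrite (bigD1 j)//= big1 ?mulr1; first by rewrite /m eqxx.
      by move=> b bj; rewrite /m (negPf bj) F0.
    have [] := gaussian_monomial mX Xindep m.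
    rewrite (E (fun b k => gauss_moment (sg b) k))//=.
    have E2 t : \prod_b X b t ^+ m b = X j t ^+ 2.
      by rewrite (E (fun b k => X b t ^+ k)).
    rewrite (_ : (fun t => _) = (fun t => (X j t ^+ 2)%:E)); last first.
      by apply/funext => t; congr EFin; exact: E2.
    by rewrite /sg /j enum_rankK /= mul1r mulr1.
  apply: EFin_inj; rewrite -Zvar unlock.
  have [i1 e1] := sq false; have [i2 e2] := sq true.
  rewrite (eq_integral (fun t => (X (enum_rank (a, false)) t ^+ 2)%:E +
      (X (enum_rank (a, true)) t ^+ 2)%:E)%E); last first.
    by move=> t _; rewrite /X !enum_rankK.
  by rewrite integralD// e1 e2 -EFinD; congr EFin; ring.
have dx (i : 'I_#|J|) a c : mpoly.mderiv i (x a c) = (i == enum_rank (a, c))%:R.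
  rewrite /x mpoly.mderivX mpoly.mnm1E eq_sym; case: eqP => [->|_].
    rewrite scale1r (_ : mpoly.mnm_sub _ _ = mpoly.mnm0) ?mpoly.mpolyX0//.
    by apply/mpoly.mnmP => k; rewrite mpoly.mnmBE subnn mpoly.mnm0E.
  by rewrite scale0r.
apply: inhabits; apply: (@WickCalculus _ _ _ _ _ _ _ A ev phi z D').
- by [].
- move=> a e t; rewrite /z /ev /= mpoly.mevalD mpoly.mevalZ !mpoly.mevalXU.
  rewrite /X !enum_rankK /= /sgn; case: (Z a t) => u w; case: e => /=.
    by apply/eqP; rewrite eq_complex/=; apply/andP; split; apply/eqP; ring.
  by apply/eqP; rewrite eq_complex/=; apply/andP; split; apply/eqP; ring.
- move=> a e f g /=; rewrite /D !mpoly.mderivM.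
  rewrite -scalerAl -scalerAr -scalerDr; congr (_ *: _).
  by rewrite scalerDr mulrDl mulrDr -!scalerAl -!scalerAr addrACA.
- move=> a e a' e' /=; rewrite /D /z !mpoly.mderivD !mpoly.mderivZ !dx.
  rewrite !(inj_eq enum_rank_inj) !xpair_eqE /=.
  case: (a == a') => /=; last first.
    by rewrite !(scaler0, addr0).
  rewrite !scaler0 !addr0 add0r scalerA.
  rewrite -[X in _ *: (X + _)]scale1r -scalerDl scalerA.
  have -> : 2^-1 * (1 + sgn e * sgn e') = (e != e')%:R.
    rewrite /sgn; case: e; case: e'; rewrite ?mulrN ?mulNr ?mulrN ?opprK sii.
    + by rewrite /= subrr mulr0.
    + by rewrite /= opprK; field.
    + by rewrite /= opprK; field.
    + by rewrite /= subrr mulr0.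
  by case: (e != e'); rewrite ?scale1r ?scale0r.
- move=> a e f /=; rewrite /z mulrDl (poly_expectD mX Xindep).
  rewrite -scalerAl (poly_expectZ mX Xindep).
  rewrite !(poly_expect_stein mX Xindep) /D (poly_expectZ mX Xindep).
  rewrite (poly_expectD mX Xindep) (poly_expectZ mX Xindep) /sg !enum_rankK /=.
  have -> : (v a)%:C = 2 * (s a ^+ 2)%:C by rewrite vE rmorphM rmorph_nat.
  move: (poly_expect _ _ _) (poly_expect P X _) (_%:C) (sgn e) => x1 x2 k g.
  by field.
Qed.

(** * Loop equations *)

Section splittings.
Context (X : Type).

(** Each triple singles out one letter, with what stands before and after it, as a term of the
    Leibniz rule does. *)
Fixpoint splits (w : seq X) : seq (seq X * X * seq X) :=
  if w is l :: w' then
    ([::], l, w') :: [seq (l :: s.1.1, s.1.2, s.2) | s <- splits w']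
  else [::].

End splittings.

Lemma splitsE (X : eqType) (w : seq X) s :
  s \in splits w -> w = s.1.1 ++ s.1.2 :: s.2.
Proof.
elim: w s => // l w IH s /=; rewrite inE => /orP[/eqP ->//|/mapP[s' s'w ->]] /=.
by rewrite {1}(IH _ s'w).
Qed.

Section loop_equation.
Context (A : comNzRingType) (C : comNzRingType) (phi : {additive A -> C}).
Context (L : eqType) (dual : L -> L) (r n : nat) (N : 'I_r -> {set 'I_n}).
Hypothesis Ndisj : forall p q i, i \in N p -> i \in N q -> p = q.
Variables (gen : L -> 'I_n -> 'I_n -> A).
Variables (der : L -> 'I_n -> 'I_n -> {additive A -> A}).
Variables (sg : L -> 'I_r -> 'I_r -> C).
Hypothesis derM : forall v i j f g,
  der v i j (f * g) = der v i j f * g + f * der v i j g.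
Hypothesis der_gen : forall v i j v' i' j',
  der v i j (gen v' i' j') = [&& v' == dual v, i' == j & j' == i]%:R.
Hypothesis by_parts : forall v a b i j f, i \in N a -> j \in N b ->
  phi (gen v i j * f) = sg v a b * phi (der v i j f).

Definition diag_block (x : 'I_r) : 'M[A]_n :=
  \matrix_(i, j) ((i == j) && (i \in N x))%:R.

Definition gen_mx (v : L) : 'M[A]_n := \matrix_(i, j) gen v i j.

(* A word together with its starting block encodes a path of blocks; each
   letter carries the block it leads to. *)
Fixpoint path_mx (x : 'I_r) (w : seq (L * 'I_r)) : 'M[A]_n :=
  if w is l :: w' then diag_block x *m gen_mx l.1 *m path_mx l.2 w'
  else diag_block x.

Definition path_end (x : 'I_r) (w : seq (L * 'I_r)) : 'I_r :=
  last x [seq l.2 | l <- w].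

Definition path_tr (kw : 'I_r * seq (L * 'I_r)) : A := \tr (path_mx kw.1 kw.2).

Lemma mul_diag_block x (M : 'M[A]_n) i j :
  (diag_block x *m M) i j = (i \in N x)%:R * M i j.
Proof.
rewrite mxE (bigD1 i)//= big1 ?addr0 => [|k ki]; rewrite mxE.
  by rewrite eqxx.
by rewrite eq_sym (negPf ki) mul0r.
Qed.

Lemma diag_blockM x y :
  diag_block x *m diag_block y = (x == y)%:R *: diag_block y.
Proof.
apply/matrixP => i j; rewrite mul_diag_block !mxE.
case: (eqVneq x y) => [->|xy]; last first.
  case: (boolP (i \in N x)) => ix; last by rewrite !mul0r.
  case: (boolP (i \in N y)) => iy; last by rewrite andbF !mulr0.
  by rewrite (Ndisj ix iy) eqxx in xy.
by case: (i \in N y); rewrite ?mul1r// andbF mulr0.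
Qed.

Lemma diag_block_path x y w :
  diag_block x *m path_mx y w = (x == y)%:R *: path_mx y w.
Proof.
case: w => [|l w] /=; first exact: diag_blockM.
by rewrite !mulmxA diag_blockM -!scalemxAl.
Qed.

Lemma path_mx_cat x w1 w2 :
  path_mx x (w1 ++ w2) = path_mx x w1 *m path_mx (path_end x w1) w2.
Proof.
elim: w1 x => [|l w1 IH] x /=.
  by rewrite diag_block_path eqxx scale1r.
by rewrite IH mulmxA.
Qed.

Lemma path_mxM x w1 y w2 : path_mx x w1 *m path_mx y w2 =
  (path_end x w1 == y)%:R *: path_mx x (w1 ++ w2).
Proof.
have e : path_mx x w1 = path_mx x w1 *m diag_block (path_end x w1).
  by rewrite -[in LHS](cats0 w1) path_mx_cat.
rewrite e -mulmxA diag_block_path -scalemxAr path_mx_cat.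
by case: eqP => [->//|_]; rewrite !scale0r.
Qed.

Section derivation.
Variables (v : L) (i j : 'I_n).
Local Notation D := (der v i j).

Lemma der1 : D 1 = 0.
Proof.
have /eqP := derM v i j 1 1.
by rewrite !mulr1 mul1r -subr_eq0 opprD addrA subrr sub0r oppr_eq0 => /eqP.
Qed.

Lemma der_nat k : D k%:R = 0.
Proof. by rewrite raddfMn der1 mul0rn. Qed.

Lemma der_mulmx m p q (M : 'M[A]_(m, p)) (M' : 'M[A]_(p, q)) :
  map_mx D (M *m M') = map_mx D M *m M' + M *m map_mx D M'.
Proof.
apply/matrixP => a b; rewrite !mxE raddf_sum -big_split /=.
by apply: eq_bigr => c _; rewrite !mxE derM.
Qed.

(** Leibniz rule along the word. The elementary matrix sits at [(j, i)], not [(i, j)], because dual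
    letters stand for a matrix and its adjoint, whose correlated entries are in transposed
    positions. *)
Lemma der_path_mx x w : map_mx D (path_mx x w) =
  \sum_(s <- splits w | s.1.2.1 == dual v)
     path_mx x s.1.1 *m delta_mx j i *m path_mx s.1.2.2 s.2.
Proof.
have dP y : map_mx D (diag_block y) = 0.
  by apply/matrixP => a b; rewrite !mxE der_nat.
have dZ u : map_mx D (gen_mx u) = (u == dual v)%:R *: delta_mx j i.
  apply/matrixP => a b; rewrite !mxE der_gen.
  by case: (u == dual v); rewrite ?mul1r ?mul0r.
elim: w x => [|l w IH] x /=; first by rewrite big_nil dP.
rewrite !der_mulmx dP mul0mx add0r dZ IH big_cons /= big_map /=.
rewrite mulmx_sumr -scalemxAr -scalemxAl.
have -> : \sum_(s <- splits w | s.1.2.1 == dual v)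
    diag_block x *m gen_mx l.1 *m (path_mx l.2 s.1.1 *m delta_mx j i *m
      path_mx s.1.2.2 s.2) =
  \sum_(s <- splits w | s.1.2.1 == dual v)
    diag_block x *m gen_mx l.1 *m path_mx l.2 s.1.1 *m delta_mx j i *m
      path_mx s.1.2.2 s.2.
  by apply: eq_bigr => s _; rewrite !mulmxA.
by case: (l.1 == dual v); rewrite ?scale1r// scale0r add0r.
Qed.

Lemma der_prod (I : Type) (ws : seq I) (F : I -> A) :
  D (\prod_(k <- ws) F k) = \sum_(S <- splits ws)
    D (F S.1.2) * \prod_(k <- S.1.1 ++ S.2) F k.
Proof.
elim: ws => [|k ws IH] /=; first by rewrite !big_nil der1.
rewrite big_cons derM IH big_cons /= big_map /= mulr_sumr; congr (_ + _).
by apply: eq_bigr => S _; rewrite big_cons mulrCA.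
Qed.

End derivation.

Lemma mul_delta_mx_entry (M M' : 'M[A]_n) i j a b :
  (M *m delta_mx j i *m M') a b = M a j * M' i b.
Proof.
rewrite mxE (bigD1 i)//= big1 ?addr0 => [|k ki]; last first.
  rewrite mxE big1 ?mul0r// => c _.
  by rewrite mxE (negPf ki) andbF mulr0.
rewrite mxE (bigD1 j)//= big1 ?addr0 => [|c cj]; last first.
  by rewrite mxE (negPf cj) /= mulr0.
by rewrite mxE !eqxx mulr1.
Qed.

Lemma path_mx_entry x w i j :
  path_mx x w i j = (i \in N x)%:R * path_mx x w i j.
Proof. by rewrite -mul_diag_block diag_block_path eqxx scale1r. Qed.

Lemma trace_restrict a c w :
  \sum_(i in N a) path_mx c w i i = (c == a)%:R * path_tr (a, w).
Proof.
rewrite big_mkcond /=.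
transitivity (\tr (diag_block a *m path_mx c w)).
  apply: eq_bigr => i _; rewrite mul_diag_block.
  by case: ifP; rewrite ?mul1r ?mul0r.
rewrite diag_block_path mxtraceZ eq_sym.
by case: eqP => [->|_]; rewrite ?mul0r.
Qed.

(** The first trace is expanded along its first letter and [by_parts] is applied entry by entry. The
    elementary matrix left by the derivative cuts the rest of the same word in two, or joins it to
    another cyclic word. A joined word forgets the blocks at which its inner pieces start, so these
    must be matched through [path_end]; in a split, a piece that does not close up has trace zero
    anyway. *)
Theorem loop_equation a v b w ws :
  phi (\prod_(kw <- (a, (v, b) :: w) :: ws) path_tr kw) = sg v a b *
  (\sum_(s <- splits w | s.1.2 == (dual v, a))
      phi (\prod_(kw <- [:: (b, s.1.1), (a, s.2) & ws]) path_tr kw) +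
   \sum_(S <- splits ws) \sum_(s <- splits S.1.2.2 |
       [&& s.1.2 == (dual v, a), path_end S.1.2.1 s.1.1 == b &
           path_end b w == a])
      phi (\prod_(kw <- (S.1.2.1, s.1.1 ++ w ++ s.2) :: S.1.1 ++ S.2)
             path_tr kw)).
Proof.
rewrite big_cons; set F := \prod_(kw <- ws) path_tr kw.
have -> : path_tr (a, (v, b) :: w) =
    \sum_(i in N a) \sum_(j in N b) gen v i j * path_mx b w j i.
  rewrite /path_tr /= /mxtrace [RHS]big_mkcond /=; apply: eq_bigr => i _.
  rewrite -mulmxA mul_diag_block; case: ifP; rewrite ?mul1r ?mul0r// => _.
  rewrite mxE [RHS]big_mkcond /=; apply: eq_bigr => j _.
  rewrite mxE path_mx_entry.
  by case: (j \in N b); rewrite /= ?mulr1n ?mulr0n !(mul1r, mul0r, mulr0).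
have -> :
    phi ((\sum_(i in N a) \sum_(j in N b) gen v i j * path_mx b w j i) * F) =
    sg v a b * phi (\sum_(i in N a) \sum_(j in N b)
      der v i j (path_mx b w j i * F)).
  rewrite mulr_suml !raddf_sum mulr_sumr; apply: eq_bigr => i ia.
  rewrite mulr_suml !raddf_sum mulr_sumr; apply: eq_bigr => j jb.
  by rewrite -mulrA (by_parts _ _ ia jb).
congr (_ * _).
have -> : \sum_(i in N a) \sum_(j in N b) der v i j (path_mx b w j i * F) =
   \sum_(i in N a) \sum_(j in N b) der v i j (path_mx b w j i) * F +
   \sum_(i in N a) \sum_(j in N b) path_mx b w j i * der v i j F.
  rewrite -big_split /=; apply: eq_bigr => i _.
  by rewrite -big_split /=; apply: eq_bigr => j _; rewrite derM.
rewrite raddfD /=; congr (_ + _).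
  (* Both pieces of the cut word are read on the diagonal, one at [j] and the other at [i], so the
     double sum becomes a product of two traces. *)
  have -> : \sum_(i in N a) \sum_(j in N b) der v i j (path_mx b w j i) * F =
      \sum_(s <- splits w | s.1.2 == (dual v, a))
        \prod_(kw <- [:: (b, s.1.1), (a, s.2) & ws]) path_tr kw.
    have dE i j : der v i j (path_mx b w j i) =
        \sum_(s <- splits w | s.1.2.1 == dual v)
          path_mx b s.1.1 j j * path_mx s.1.2.2 s.2 i i.
      have /matrixP/(_ j i) := der_path_mx v i j b w.
      rewrite mxE => ->; rewrite summxE; apply: eq_bigr => s _.
      exact: mul_delta_mx_entry.
    under eq_bigr do under eq_bigr do rewrite dE mulr_suml.
    under eq_bigr do rewrite exchange_big /=.
    rewrite exchange_big /= [RHS]big_mkcond [LHS]big_mkcond /=.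
    apply: eq_bigr => -[[w1 [v' c]] w2] _ /=.
    rewrite xpair_eqE; case: (v' == dual v) => //=.
    rewrite !big_cons -/F.
    under eq_bigr => i _ do
      (rewrite -mulr_suml -mulr_suml trace_restrict eqxx mul1r).
    rewrite -mulr_suml -mulr_sumr trace_restrict.
    by case: eqP => _; rewrite ?(mul1r, mul0r, mulr0) ?mulrA.
  by rewrite raddf_sum.
have -> : \sum_(i in N a) \sum_(j in N b) path_mx b w j i * der v i j F =
    \sum_(S <- splits ws) (\sum_(i in N a) \sum_(j in N b)
      path_mx b w j i * der v i j (path_tr S.1.2)) *
      \prod_(kw <- S.1.1 ++ S.2) path_tr kw.
  under eq_bigr do under eq_bigr do rewrite der_prod mulr_sumr.
  under eq_bigr do rewrite exchange_big /=.
  rewrite exchange_big /=; apply: eq_bigr => S _.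
  rewrite mulr_suml; apply: eq_bigr => i _; rewrite mulr_suml.
  by apply: eq_bigr => j _; rewrite mulrA.
rewrite raddf_sum; apply: eq_bigr => -[[ws1 [k wk]] ws2] _ /=.
have -> : \sum_(i in N a) \sum_(j in N b)
      path_mx b w j i * der v i j (path_tr (k, wk)) =
    \sum_(s <- splits wk | [&& s.1.2 == (dual v, a), path_end k s.1.1 == b &
           path_end b w == a]) path_tr (k, s.1.1 ++ w ++ s.2).
  have dE i j : der v i j (path_tr (k, wk)) =
        \sum_(s <- splits wk | s.1.2.1 == dual v) \sum_x
          path_mx k s.1.1 x j * path_mx s.1.2.2 s.2 i x.
    rewrite /path_tr /= /mxtrace raddf_sum exchange_big /=.
    apply: eq_bigr => x _; have /matrixP/(_ x x) := der_path_mx v i j k wk.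
    rewrite mxE => ->; rewrite summxE; apply: eq_bigr => s _.
    exact: mul_delta_mx_entry.
  under eq_bigr do under eq_bigr do rewrite dE mulr_sumr.
  under eq_bigr do rewrite exchange_big /=.
  rewrite exchange_big /= [RHS]big_mkcond [LHS]big_mkcond /=.
  apply: eq_bigr => -[[w1 [v' c]] w2] _ /=.
  rewrite xpair_eqE; case: (v' == dual v) => //=.
  (* The sum over [N a] is inserted as [diag_block a]; the one over [N b] needs no insertion, since
     [path_mx b w] already begins with that projection. *)
  transitivity
    (\tr (path_mx k w1 *m (path_mx b w *m (diag_block a *m path_mx c w2)))).
    rewrite /mxtrace.
    under [RHS]eq_bigr => x _ do rewrite mxE.
    under eq_bigr do under eq_bigr do rewrite mulr_sumr.
    rewrite [RHS]exchange_big /= exchange_big /= big_mkcond /=.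
    apply: eq_bigr => j _.
    have -> : \sum_(x < n) path_mx k w1 x j *
       (path_mx b w *m (diag_block a *m path_mx c w2)) j x =
      \sum_x \sum_(i in N a)
        path_mx b w j i * (path_mx k w1 x j * path_mx c w2 i x).
      apply: eq_bigr => x _; rewrite mxE mulr_sumr [RHS]big_mkcond /=.
      apply: eq_bigr => i _; rewrite mul_diag_block.
      by case: ifP => _; rewrite ?(mul1r, mul0r, mulr0)// mulrCA.
    rewrite [RHS]exchange_big /=; case: ifP => // jb.
    rewrite big1// => i _; rewrite big1// => x _.
    by rewrite path_mx_entry jb !mul0r.
  rewrite diag_block_path -!scalemxAr mxtraceZ eq_sym.
  case: eqP => [->|_]; last by rewrite mul0r.
  rewrite mul1r /= mulmxA path_mxM -scalemxAl mxtraceZ.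
  case: eqP => [e|_]; last by rewrite mul0r.
  rewrite mul1r path_mxM mxtraceZ catA.
  have -> : path_end k (w1 ++ w) = path_end b w.
    by rewrite /path_end map_cat last_cat -/(path_end k w1) e.
  by case: eqP => _; rewrite ?mul1r ?mul0r.
rewrite mulr_suml raddf_sum; apply: eq_bigr => s _.
by rewrite big_cons.
Qed.

End loop_equation.

(** * Limit of the loop equations *)

Lemma cvg_mull (K : numFieldType) (c : K) (u : nat -> K) (l : K) :
  u n @[n --> \oo] --> l -> c * u n @[n --> \oo] --> c * l.
Proof. by apply: cvgM; exact: cvg_cst. Qed.

Lemma cvg_sum_seq (K : numFieldType) (I : eqType) (s : seq I) (Q : pred I)
    (f : I -> nat -> K) (l : I -> K) :
  (forall i, i \in s -> Q i -> f i n @[n --> \oo] --> l i) ->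
  \sum_(i <- s | Q i) f i n @[n --> \oo] --> \sum_(i <- s | Q i) l i.
Proof.
elim: s => [|i s IH] h.
  by under eq_fun do rewrite big_nil; rewrite big_nil; exact: cvg_cst.
under eq_fun do rewrite big_cons; rewrite big_cons.
have {}IH : \sum_(i <- s | Q i) f i n @[n --> \oo] --> \sum_(i <- s | Q i) l i.
  by apply: IH => j js; apply: h; rewrite inE js orbT.
case: ifP => // Qi; apply: cvgD => //.
by apply: h => //; rewrite inE eqxx.
Qed.

Section loop_limit.
Context (K : numFieldType) (L : eqType) (dual : L -> L) (r n0 : nat).
Local Notation word := (seq (L * 'I_r)).
Variables (e : nat -> seq ('I_r * word) -> K).
Variables (kap eta : nat -> 'I_r -> K) (c : 'I_r -> K).
Variables (S : L -> 'I_r -> 'I_r -> K).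
Variables (mu : 'I_r -> word -> K).
Hypothesis kap_cvg : forall k, kap n k @[n --> \oo] --> c k.
Hypothesis eta_cvg : forall k, eta n k @[n --> \oo] --> (0 : K).
Hypothesis e0 : forall n, (n0 <= n)%N -> e n [::] = 1.
Hypothesis e_nil : forall n k ws, (n0 <= n)%N -> e n ((k, [::]) :: ws) = e n ws.
Hypothesis e_loop : forall n a v b w ws, (n0 <= n)%N ->
  e n ((a, (v, b) :: w) :: ws) = S v a b *
  (kap n b * (\sum_(s <- splits w | s.1.2 == (dual v, a))
      e n [:: (b, s.1.1), (a, s.2) & ws]) +
   eta n a * \sum_(T <- splits ws) \sum_(s <- splits T.1.2.2 |
       [&& s.1.2 == (dual v, a), path_end T.1.2.1 s.1.1 == b &
           path_end b w == a])
      e n ((T.1.2.1, s.1.1 ++ w ++ s.2) :: T.1.1 ++ T.2)).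
Hypothesis mu_nil : forall k, mu k [::] = 1.
Hypothesis mu_loop : forall a v b w, mu a ((v, b) :: w) = S v a b *
  (c b * \sum_(s <- splits w | s.1.2 == (dual v, a)) mu b s.1.1 * mu a s.2).

Let weight (ws : seq ('I_r * word)) : nat := \sum_(kw <- ws) (size kw.2).+1.

(** Induction on the number of letters plus the number of words: a splitting removes two letters and
    adds a word, a merging removes two letters and a word, and dropping an empty word removes one.
    The merged terms converge by induction, so the factor [eta] kills them. *)
Lemma loop_limit ws : e n ws @[n --> \oo] --> \prod_(kw <- ws) mu kw.1 kw.2.
Proof.
have [m wm] := ubnP (weight ws); elim: m ws wm => // m IH ws.
have near_e (f g : nat -> K) (l : K) : (forall n, (n0 <= n)%N -> f n = g n) ->
    g n @[n --> \oo] --> l -> f n @[n --> \oo] --> l.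
  move=> fg; apply: cvg_trans; apply: near_eq_cvg; near=> n.
  by rewrite fg//; near: n; exact: nbhs_infty_ge.
case: ws => [_|[a [|[v b] w]] ws] wm.
- rewrite big_nil; apply: (near_e (e ^~ [::]) (fun=> 1)); first exact: e0.
  exact: cvg_cst.
- rewrite big_cons mu_nil mul1r.
  apply: (near_e (e ^~ ((a, [::]) :: ws)) (e ^~ ws)).
    by move=> n; exact: e_nil.
  by apply: IH; move: wm; rewrite /weight big_cons /= add1n ltnS.
have {}wm : ((size w).+1 + weight ws < m)%N.
  by move: wm; rewrite /weight big_cons /= addSn ltnS.
apply: (near_e _ _ _ (fun n => e_loop a v b w ws (n := n))).
rewrite big_cons /= mu_loop -mulrA; apply: cvgM; first exact: cvg_cst.
rewrite -[X in _ --> X]addr0; apply: cvgD.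
  rewrite -mulrA mulr_suml; apply: cvgM; first exact: kap_cvg.
  apply: cvg_sum_seq => -[[w1 l] w2] /= /splitsE /= wE _.
  have -> : mu b w1 * mu a w2 * \prod_(kw <- ws) mu kw.1 kw.2 =
      \prod_(kw <- [:: (b, w1), (a, w2) & ws]) mu kw.1 kw.2.
    by rewrite !big_cons /= mulrA.
  apply: IH; apply: leq_trans wm; rewrite wE /weight !big_cons size_cat /=.
  by lia.
rewrite -[X in _ --> X](mul0r (\sum_(T <- splits ws) \sum_(s <- splits T.1.2.2 |
       [&& s.1.2 == (dual v, a), path_end T.1.2.1 s.1.1 == b &
           path_end b w == a])
      \prod_(kw <- (T.1.2.1, s.1.1 ++ w ++ s.2) :: T.1.1 ++ T.2) mu kw.1 kw.2)).
apply: cvgM; first exact: eta_cvg.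
apply: cvg_sum_seq => -[[ws1 [k wk]] ws2] /= /splitsE /= wsE _.
apply: cvg_sum_seq => -[[w1 l] w2] /= /splitsE /= wkE _.
apply: IH; apply: leq_trans wm; rewrite wsE wkE /weight !(big_cons, big_cat) /=.
by rewrite !size_cat /=; lia.
Unshelve. all: by end_near. Qed.

End loop_limit.

(** * Moments on the Fock space *)

Definition dual_letter (U : Type) (v : U + U) : U + U :=
  match v with inl u => inr u | inr u => inl u end.

Section block_letters.
Context (r : nat) (V : Type).

(** When it fails, neighbouring projections or operators have incompatible blocks, and the moment is
    zero for the matrices and on the Fock space alike. When it holds, the target blocks kept by
    [path_of] determine the sources. *)
Fixpoint composable (x : 'I_r) (ls : seq ('I_r * 'I_r * V)) : bool :=
  if ls is l :: ls' then (l.1.1 == x) && composable l.1.2 ls' else true.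

Definition path_of (ls : seq ('I_r * 'I_r * V)) : seq (V * 'I_r) :=
  [seq (l.2, l.1.2) | l <- ls].

End block_letters.

Section fock_paths.
Context (R : realType) (r : nat) (U : finType) (B : U -> 'M[R]_r).
Local Notation letter := (U + U)%type.
Local Notation fock := (l2 R (fock_basis r U)).

Definition letter_op (l : 'I_r * 'I_r * letter) (x : fock) : fock :=
  creation B l.1.1 l.1.2 l.2 x + annihilation B l.1.2 l.1.1 (dual_letter l.2) x.

Definition star_letter (eps : bool) (p q : 'I_r) (u : U) :
    'I_r * 'I_r * letter :=
  if eps then (q, p, inr u) else (p, q, inl u).

(** Taking the adjoint exchanges the creation and annihilation parts of [zeta], which amounts to
    swapping [p] with [q] and u' with u''. *)
Lemma star_zetaE eps p q u :
  star_op eps (zeta B p q u) = letter_op (star_letter eps p q u).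
Proof.
have zE : zeta B p q u = letter_op (p, q, inl u).
  by apply/funext => x; rewrite /zeta adjoint_creation.
case: eps => //=; apply: adjointE; rewrite zE => x y.
rewrite (is_adjointD (is_adjoint_creation B p q (inl u))
  (is_adjoint_sym (is_adjoint_creation B q p (inr u)))).
by rewrite /letter_op addrC.
Qed.

Definition lefti (k : 'I_r) (y : seq ('I_r * letter)) : 'I_r :=
  left_index (y, k).

(* The coordinate at (y, k) of the vector obtained from Omega_k by applying the
   operators along a path of blocks that starts at the left index of y. *)
Fixpoint fock_coef (k : 'I_r) (w : seq (letter * 'I_r))
    (y : seq ('I_r * letter)) : R[i] :=
  if w is (v, b) :: w' then
    (if y is (a, v') :: y' then
       if (v' == v) && (lefti k y' == b) then coef B a b v * fock_coef k w' y'
       else 0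
     else 0) +
    coef B b (lefti k y) (dual_letter v) *
      fock_coef k w' ((b, dual_letter v) :: y)
  else (y == [::])%:R.

(** The operator applied last either created the first factor of [y] or removed a factor in front of
    [y], so the induction has to run over all [y]. The final index [k] never changes, hence only
    coordinates [(y, k)] occur. *)
Lemma letter_ops_vacuum k ls y :
  (\big[comp/id]_(l <- ls) letter_op l) (vacuum R U k) (y, k) =
  (composable (lefti k y) ls)%:R * fock_coef k (path_of ls) y.
Proof.
elim: ls y => [|[[a b] v] ls IH] y.
  by rewrite big_nil /= mul1r xpair_eqE eqxx andbT.
rewrite big_cons /comp /letter_op l2D.
set x := (\big[comp/id]_(l <- ls) letter_op l) (vacuum R U k).
have -> : annihilation B b a (dual_letter v) x (y, k) =
    (a == lefti k y)%:R * ((composable b ls)%:R *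
      (coef B b (lefti k y) (dual_letter v) *
       fock_coef k (path_of ls) ((b, dual_letter v) :: y))).
  rewrite /annihilation /= eq_sym /prepend /= -/(lefti k y).
  case: eqP => [<-|_]; last by rewrite mul0r.
  by rewrite mul1r IH /= mulrCA.
have -> : creation B a b v x (y, k) =
    (a == lefti k y)%:R * ((composable b ls)%:R *
      (if y is (a', v') :: y' then
       if (v' == v) && (lefti k y' == b)
       then coef B a' b v * fock_coef k (path_of ls) y'
       else 0 else 0)).
  case: y => [|[a' v'] y]; first by rewrite /= /creation_fun !mulr0.
  rewrite /= /creation_fun /= eq_sym -/(lefti k y).
  have -> : (a == lefti k ((a', v') :: y)) = (a == a') by [].
  case: eqP => [<-|_] /=; last by rewrite mul0r.
  rewrite mul1r; case: (v' == v) => /=; last by rewrite mulr0.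
  case: eqP => [<-|_]; last by rewrite mulr0.
  by rewrite IH mulrCA.
rewrite -!mulrDr mulrA /= -natrM mulnb.
by congr (_ * _).
Qed.

Lemma Psi_letter_ops k ls : Psi k (\big[comp/id]_(l <- ls) letter_op l) =
  (composable k ls)%:R * fock_coef k (path_of ls) [::].
Proof. by rewrite /Psi dot_delta letter_ops_vacuum. Qed.

(* Decomposition at the last time when the coordinate (b, v0) is created: from
   then on the operators act on the coordinates in front of it, as they would
   on a path started from Omega_b. *)
Lemma fock_coef_last_passage k w s b v0 y :
  fock_coef k w (s ++ (b, v0) :: y) =
  \sum_(t <- splits w | t.1.2 == (v0, lefti k y))
    coef B b (lefti k y) v0 * (fock_coef b t.1.1 s * fock_coef k t.2 y).
Proof.
(* Factors in front of [(b, v0)] see the block [b] behind them, exactly as if they stood on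
   Omega_b. *)
have left_cat z : lefti k (z ++ (b, v0) :: y) = lefti b z by case: z => [|[]].
elim: w s => [|[v c] w IH] s; first by rewrite big_nil; case: s.
(* The first letter acts in front of [(b, v0)] or, if [s] is empty, may itself have created it; the
   latter is the split at the head of the word. *)
have E : fock_coef k ((v, c) :: w) (s ++ (b, v0) :: y) =
    (if s is [::] then
      if (v0 == v) && (lefti k y == c) then coef B b c v * fock_coef k w y
      else 0 else 0) +
    \sum_(t <- splits w | t.1.2 == (v0, lefti k y))
    coef B b (lefti k y) v0 *
      (fock_coef b ((v, c) :: t.1.1) s * fock_coef k t.2 y).
  rewrite /= (IH ((c, dual_letter v) :: s)) left_cat mulr_sumr.
  case: s => [|[a v'] s] /=.
    congr (_ + _); apply: eq_bigr => t _; rewrite add0r; ring.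
  rewrite left_cat IH add0r; case: ifP => _.
    rewrite mulr_sumr -big_split /=; apply: eq_bigr => t _; ring.
  by rewrite add0r; apply: eq_bigr => t _; ring.
rewrite E /= big_cons big_map /=; case: s {E} => [|l s] /=.
  rewrite xpair_eqE eq_sym (eq_sym c).
  case: ifP => [/andP[/eqP -> /eqP ->]|_]; last by rewrite add0r.
  by rewrite mul1r.
by rewrite add0r; case: ifP => // _; rewrite mul0r mulr0 add0r.
Qed.

(** The vacuum coordinate has no factor that could have been created, so the first letter
    annihilates [(b, dual_letter v)]. Its annihilation and its creation each contribute the square
    root of the same entry of [B]. *)
Lemma fock_coef_loop a v b w : (forall u p q, 0 <= B u p q) ->
  fock_coef a ((v, b) :: w) [::] = (B (base_letter v) b a)%:C *
  \sum_(t <- splits w | t.1.2 == (dual_letter v, a))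
    fock_coef b t.1.1 [::] * fock_coef a t.2 [::].
Proof.
move=> B0; rewrite /= add0r -[[:: _]]/([::] ++ [:: _]) fock_coef_last_passage.
rewrite -mulr_sumr mulrA; congr (_ * _).
rewrite /coef -rmorphM /= -expr2 sqr_sqrtr//.
by case: v.
Qed.

End fock_paths.

(** * Block Gaussian matrices *)

Section finite_size.
Context (R : realType) (r : nat) (U : finType).
Context (n : nat) (N : 'I_r -> {set 'I_n}).
Hypothesis hN : interval_partition N.
Context (disp : measure_display) (T : measurableType disp).
Context (P : probability T R).
Variables (V : U -> 'M[R]_r) (Y : U -> T -> 'M[R[i]]_n).
Hypothesis Vsym : forall u, (V u)^T = V u.
Hypothesis Yindep : mutually_independent P
  (fun (a : U * 'I_n * 'I_n) t => Y a.1.1 t a.1.2 a.2).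
Hypothesis Ygauss : forall u i j, circular_gaussian P (fun t => Y u t i j).
Hypothesis Yvar : forall u p q (i j : 'I_n), i \in N p -> j \in N q ->
  'E_P[fun t => cabs2 (Y u t i j)]%E = (V u p q / n%:R)%:E.
Local Notation letter := (U + U)%type.
Local Notation word := (seq (letter * 'I_r)).

Definition letter_mx (l : 'I_r * 'I_r * letter) (t : T) : 'M[R[i]]_n :=
  Defs.proj_mx R N l.1.1 *m
    (match l.2 with inl u => Y u t | inr u => star_mx true (Y u t) end) *m
  Defs.proj_mx R N l.1.2.

Lemma star_blockE eps p q u t :
  star_mx eps (block N p q (Y u t)) = letter_mx (star_letter eps p q u) t.
Proof.
case: eps => //=; rewrite /letter_mx /block /=.
have pE x : star_mx true (Defs.proj_mx R N x) = Defs.proj_mx R N x.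
  apply/matrixP => i j; rewrite !mxE rmorph_nat eq_sym.
  by case: eqP => // ->.
rewrite !trmx_mul !map_mxM /= mulmxA.
by congr (_ *m _ *m _); exact: pE.
Qed.

Lemma card_block_gt0 k : (0 < #|N k|)%N.
Proof. by have [/(_ k)[i iN] _ _ _] := hN; apply/card_gt0P; exists i. Qed.

(* The products of normalized traces: the loop equations close on them. *)
Lemma finite_size_loop : exists e : seq ('I_r * word) -> R[i],
  [/\ e [::] = 1,
      forall k ws, e ((k, [::]) :: ws) = e ws,
      forall a v b w ws, e ((a, (v, b) :: w) :: ws) =
        (V (base_letter v) a b)%:C *
        ((#|N b|%:R / n%:R)%:C *
           (\sum_(s <- splits w | s.1.2 == (dual_letter v, a))
             e [:: (b, s.1.1), (a, s.2) & ws]) +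
         ((n%:R * #|N a|%:R)^-1)%:C *
           \sum_(S <- splits ws) \sum_(s <- splits S.1.2.2 |
             [&& s.1.2 == (dual_letter v, a), path_end S.1.2.1 s.1.1 == b &
                 path_end b w == a])
             e ((S.1.2.1, s.1.1 ++ w ++ s.2) :: S.1.1 ++ S.2)) &
      forall k ls,
        partial_trace N P k (fun t => \prod_(l <- ls) letter_mx l t) =
        (composable k ls)%:R * e [:: (k, path_of ls)]].
Proof.
have [_ Ndisj Ncover _] := hN.
(* The block of an index is chosen as a function in order to express the variance of a single
   entry. *)
have /choice[blk blkP] : forall i, exists q, i \in N q by [].
have blkE i q : i \in N q -> blk i = q by move=> iq; exact: Ndisj (blkP i) iq.
pose va (a : U * 'I_n * 'I_n) := V a.1.1 (blk a.1.2) (blk a.2) / n%:R.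
have [W] : inhabited (wick_calculus P
    (fun (a : U * 'I_n * 'I_n) t => Y a.1.1 t a.1.2 a.2) va).
  apply: gaussian_wick => // a.
  by apply: Yvar; exact: blkP.
pose A := wick_ring W.
pose phi := wick_expect W.
(* The letter [inr u] at [(i, j)] is the conjugate of the entry [(j, i)], as in the adjoint
   matrix. *)
pose gen (v : letter) i j : A := match v with
  inl u => wick_gen W (u, i, j) false | inr u => wick_gen W (u, j, i) true end.
pose der (v : letter) i j : {additive A -> A} := match v with
  inl u => wick_der W (u, i, j) false | inr u => wick_der W (u, j, i) true end.
pose sg (v : letter) a b : R[i] := (V (base_letter v) a b / n%:R)%:C.
have derM v i j f g : der v i j (f * g) = der v i j f * g + f * der v i j g.
  by case: v => u; exact: wick_derM.
have der_gen v i j v' i' j' : der v i j (gen v' i' j') =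
    [&& v' == dual_letter v, i' == j & j' == i]%:R.
  case: v v' => u [u'|u'] /=; rewrite wick_der_gen ?andbF ?andbT //= !xpair_eqE.
    rewrite -[_ == inr u]/(u' == u) (eq_sym u') (eq_sym i') (eq_sym j').
    by rewrite -andbA [X in _ && X]andbC.
  rewrite -[_ == inl u]/(u' == u) (eq_sym u') (eq_sym i') (eq_sym j').
  by rewrite -andbA.
have by_parts v a b i j f : i \in N a -> j \in N b ->
    phi (gen v i j * f) = sg v a b * phi (der v i j f).
  move=> ia jb; rewrite /phi /gen /der /sg.
  case: v => u; rewrite wick_by_parts /va /= (blkE _ _ ia) (blkE _ _ jb) //.
  (* For a starred letter the underlying entry lies in block [(b, a)]; symmetry identifies its
     variance with that of block [(a, b)]. *)
  by rewrite -[in RHS]Vsym mxE.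
pose tr := path_tr (A := A) N gen.
pose size_ (kw : 'I_r * word) : R[i] := #|N kw.1|%:R.
have size0 kw : size_ kw != 0.
  by rewrite /size_ pnatr_eq0 -lt0n card_block_gt0.
have phi1 : phi 1 = 1.
  rewrite /phi wick_expectE.
  have -> : (fun t => wick_eval W t 1) = (fun=> 1%:C).
    by apply/funext => t; rewrite rmorph1.
  rewrite cexpect_real; have := expectation_cst P (1 : R).
  by rewrite unlock => ->.
pose e ws := phi (\prod_(kw <- ws) tr kw) / \prod_(kw <- ws) size_ kw.
exists e; split.
- by rewrite /e !big_nil phi1 divr1.
- move=> k ws; rewrite /e !big_cons.
  have -> : tr (k, [::]) = #|N k|%:R.
    rewrite /tr /path_tr /= /mxtrace -sum1_card natr_sum.
    rewrite [RHS]big_mkcond; apply: eq_bigr => i _.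
    by rewrite mxE eqxx /=; case: (i \in N k).
  rewrite mulr_natl raddfMn -mulr_natl -/(size_ (k, [::])).
  by rewrite invfM mulrACA divff ?size0// mul1r.
- move=> a v b w ws; rewrite {1}/e.
  rewrite (loop_equation Ndisj derM der_gen by_parts) big_cons -/tr.
  set Q := \prod_(kw <- ws) size_ kw.
  have Q0 : Q != 0.
    by rewrite prodf_seq_neq0; apply/allP => kw _; exact/implyP.
  set X1 := \sum_(s <- splits w | _) phi _.
  set X2 := \sum_(S <- splits ws) \sum_(s <- _ | _) phi _.
  set Y1 := \sum_(s <- splits w | _) e _.
  set Y2 := \sum_(S <- splits ws) \sum_(s <- _ | _) e _.
  (* The normalization of the left side is n_a times [Q]. A splitting has n_b n_a [Q] and a merging
     has [Q]; with the variance factor 1/n this leaves n_b / n and 1 / (n n_a). *)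
  have -> : Y1 = X1 / (#|N b|%:R * (#|N a|%:R * Q)).
    by rewrite mulr_suml; apply: eq_bigr => s _; rewrite /e !big_cons.
  have -> : Y2 = X2 / Q.
    rewrite mulr_suml; apply: eq_big_seq => S /splitsE wsE.
    rewrite mulr_suml; apply: eq_bigr => s _; rewrite /e; congr (_ / _).
    by rewrite big_cons /Q wsE !big_cat big_cons /= mulrCA.
  have n0 : n%:R != 0 :> R[i].
    have [/(_ a)[i _] _ _ _] := hN.
    by rewrite pnatr_eq0 -lt0n; exact: leq_ltn_trans (ltn_ord i).
  have a0 : #|N a|%:R != 0 :> R[i] := size0 (a, [::]).
  have b0 : #|N b|%:R != 0 :> R[i] := size0 (b, [::]).
  rewrite /sg /size_ /= !(fmorph_div, rmorphM, fmorphV) !rmorph_nat.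
  by field; rewrite n0 a0 b0 Q0.
- move=> k ls; rewrite /partial_trace.
  pose lA (l : 'I_r * 'I_r * letter) :=
    diag_block A N l.1.1 *m gen_mx gen l.2 *m diag_block A N l.1.2.
  have dAE x t : map_mx (wick_eval W t) (diag_block A N x) = Defs.proj_mx R N x.
    by apply/matrixP => i j; rewrite !mxE rmorph_nat.
  have lAE l t : map_mx (wick_eval W t) (lA l) = letter_mx l t.
    rewrite /lA /letter_mx !map_mxM /= !dAE; congr (_ *m _ *m _).
    apply/matrixP => i j; rewrite !mxE /gen.
    by case: l.2 => u; rewrite wick_eval_gen //= !mxE.
  (* Adjacent projections merge if their blocks agree and give zero otherwise. The projection in
     front accounts for the partial trace being a sum over [N k] only. *)
  have prodE x : diag_block A N x *m (\prod_(l <- ls) lA l) =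
      (composable x ls)%:R *: path_mx N gen x (path_of ls).
    elim: ls x => [|l ls' IH] x; first by rewrite big_nil mulmx1 scale1r.
    rewrite big_cons -[lA l * _]/(lA l *m _) /lA !mulmxA.
    rewrite (diag_blockM _ Ndisj) -!scalemxAl -!mulmxA IH -!scalemxAr /=.
    rewrite scalerA !mulmxA -natrM mulnb eq_sym.
    by case: eqP => [->|_] //=; rewrite !scale0r.
  have -> : (fun t => \sum_(i in N k) (\prod_(l <- ls) letter_mx l t) i i) =
      (fun t => wick_eval W t ((composable k ls)%:R * tr (k, path_of ls))).
    apply/funext => t; rewrite /tr /path_tr /= -mxtraceZ -prodE -trace_map_mx.
    rewrite map_mxM /= dAE.
    have -> : map_mx (wick_eval W t) (\prod_(l <- ls) lA l) =
        \prod_(l <- ls) letter_mx l t.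
      elim: ls {prodE} => [|l ls' IH]; first by rewrite !big_nil map_mx1.
      rewrite !big_cons -[lA l * _]/(lA l *m _) map_mxM /=.
      by rewrite lAE IH.
    rewrite big_mkcond /= /mxtrace; apply: eq_bigr => i _.
    rewrite mul_diag_block.
    by case: (i \in N k); rewrite ?mul1r ?mul0r.
  rewrite -wick_expectE -/phi /e !big_seq1 /size_ /=.
  case: (composable k ls); first by rewrite !mul1r mulrC.
  by rewrite !mul0r raddf0 mulr0.
Qed.

End finite_size.

(** * Convergence of the mixed moments *)

Lemma cvg_real_complex (R : realType) (u : nat -> R) (l : R) :
  u n @[n --> \oo] --> l ->
  (u n)%:C @[n --> \oo] --> (l%:C : (R[i] : numFieldType)).
Proof.
move=> ul.
apply/(@cvgrPdist_lt (R[i] : numFieldType) (R[i] : numFieldType)^o) => eps eps0.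
(* A positive element of [R[i]] is real, so the radius may be taken in [R]. *)
have epsE : eps = (complex.Re eps)%:C by rewrite RRe_real// gtr0_real.
have e0 : 0 < complex.Re eps by rewrite -ltcR -epsE.
near=> n; rewrite epsE -rmorphB normc_def /= expr0n /= addr0 sqrtr_sqr ltcR.
by near: n; exact: cvgr_dist_lt.
Unshelve. all: by end_near. Qed.

Theorem theorem4p1 (R : realType) (r : nat) (hr : (1 <= r)%N) (U : finType)
  (N : forall n : nat, 'I_r -> {set 'I_n})
  (hN : forall n, (r <= n)%N -> interval_partition (N n))
  (d : 'rV[R]_r)
  (hd0 : forall q, 0 <= d 0 q)
  (hd : forall q, (#|N n q|%:R / n%:R : R) @[n --> \oo] --> d 0 q)
  (V : U -> 'M[R]_r)
  (hV0 : forall u p q, 0 <= V u p q)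
  (hVsym : forall u, (V u)^T = V u)
  (disp : measure_display) (T : measurableType disp) (P : probability T R)
  (Y : U -> forall n : nat, T -> 'M[R[i]]_n)
  (hYindep : forall n, (r <= n)%N ->
     mutually_independent P
       (fun (a : U * 'I_n * 'I_n) t => Y a.1.1 n t a.1.2 a.2))
  (hYgauss : forall n, (r <= n)%N -> forall u (i j : 'I_n),
     circular_gaussian P (fun t => Y u n t i j))
  (hYvar : forall n, (r <= n)%N -> forall u p q (i j : 'I_n),
     i \in N n p -> j \in N n q ->
     'E_P[fun t => cabs2 (Y u n t i j)]%E = (V u p q / n%:R)%:E)
  (k : 'I_r) (m : nat) (p q : 'I_m -> 'I_r) (u : 'I_m -> U)
  (eps : 'I_m -> bool) :
  partial_trace (N n) P k (fun t => \prod_(j < m)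
    star_mx (eps j) (block (N n) (p j) (q j) (Y (u j) n t)))
  @[n --> \oo] -->
  (Psi k (\big[comp/id]_(j < m)
     star_op (eps j) (zeta (fun u => diag_mx d *m V u) (p j) (q j) (u j)))
   : (R[i] : numFieldType)).
Proof.
pose word := seq ((U + U) * 'I_r).
pose kap n b : R[i] := (#|N n b|%:R / n%:R)%:C.
pose eta n a : R[i] := ((n%:R * #|N n a|%:R)^-1)%:C.
pose S (v : U + U) a b : R[i] := (V (base_letter v) a b)%:C.
have /choice[e he] : forall n, exists e : seq ('I_r * word) -> R[i],
  (r <= n)%N ->
  [/\ e [::] = 1,
      forall k ws, e ((k, [::]) :: ws) = e ws,
      forall a v b w ws, e ((a, (v, b) :: w) :: ws) = S v a b *
        (kap n b *
           (\sum_(s <- splits w | s.1.2 == (dual_letter v, a))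
             e [:: (b, s.1.1), (a, s.2) & ws]) +
         eta n a *
           \sum_(S <- splits ws) \sum_(s <- splits S.1.2.2 |
             [&& s.1.2 == (dual_letter v, a), path_end S.1.2.1 s.1.1 == b &
                 path_end b w == a])
             e ((S.1.2.1, s.1.1 ++ w ++ s.2) :: S.1.1 ++ S.2)) &
      forall k ls, partial_trace (N n) P k
          (fun t => \prod_(l <- ls) letter_mx (N n) (fun u => Y u n) l t) =
        (composable k ls)%:R * e [:: (k, path_of ls)]].
  (* For [n < r] nothing is claimed, and zero is a dummy value. *)
  move=> n; have [rn|_] := leqP r n; last by exists (fun=> 0).
  have [e [h1 h2 h3 h4]] := @finite_size_loop R r U n (N n) (hN n rn) _ T P V
    (fun u => Y u n) hVsym (hYindep n rn) (hYgauss n rn) (hYvar n rn).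
  by exists e.
pose ls := [seq star_letter (eps j) (p j) (q j) (u j) | j <- index_enum 'I_m].
have cvg_e : e n [:: (k, path_of ls)] @[n --> \oo] -->
    (\prod_(kw <- [:: (k, path_of ls)])
      fock_coef (fun u => diag_mx d *m V u) kw.1 kw.2 [::]
     : (R[i] : numFieldType)).
  apply: (@loop_limit (R[i] : numFieldType) _ (@dual_letter U) r r e kap eta
    (fun b => (d 0 b)%:C) S
    (fun k w => fock_coef (fun u => diag_mx d *m V u) k w [::])).
  - by move=> b; apply: cvg_real_complex; exact: hd.
  - move=> a; apply: cvg_real_complex.
    apply: (@squeeze_cvgr _ _ _ _ (fun=> 0) (fun n => n%:R^-1)); last 2 first.
    + exact: cvg_cst.
    + apply/gtr0_cvgV0; last exact: cvgr_idn.
      by near=> n; rewrite ltr0n; near: n; exact: nbhs_infty_gt.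
    near=> n; rewrite invr_ge0 mulr_ge0//= invfM ler_piMr ?invr_ge0//.
    rewrite invf_le1 ?ltr0n ?ler1n ?card_block_gt0//; apply: hN;
    by near: n; exact: nbhs_infty_ge.
  - by move=> n rn; have [] := he n rn.
  - by move=> n k' ws rn; have [_ h _ _] := he n rn; exact: h.
  - by move=> n a v b w ws rn; have [_ _ h _] := he n rn; exact: h.
  - by [].
  - move=> a v b w; rewrite fock_coef_loop; last first.
      by move=> v' p' q'; rewrite mul_diag_mx !mxE mulr_ge0.
    (* The Fock weight is the entry [(b, a)] of DV, that is d_b v_{b,a}; symmetry turns it into
       v_{a,b} times the limit of [kap n b]. *)
    rewrite mul_diag_mx mxE -[in LHS]hVsym mxE rmorphM /= /S.
    by rewrite mulrA [X in X * _]mulrC.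
have -> : Psi k (\big[comp/id]_(j < m)
     star_op (eps j) (zeta (fun u => diag_mx d *m V u) (p j) (q j) (u j))) =
    (composable k ls)%:R *
    fock_coef (fun u => diag_mx d *m V u) k (path_of ls) [::].
  rewrite -Psi_letter_ops big_map; congr Psi.
  by apply: eq_bigr => j _; rewrite star_zetaE.
rewrite big_seq1 /= in cvg_e.
have cvg_ce : (composable k ls)%:R * e n [:: (k, path_of ls)] @[n --> \oo] -->
    ((composable k ls)%:R *
     fock_coef (fun u => diag_mx d *m V u) k (path_of ls) [::]
     : (R[i] : numFieldType)).
  exact: cvg_mull cvg_e.
apply: cvg_trans cvg_ce; apply: near_eq_cvg; near=> n.
have rn : (r <= n)%N by near: n; exact: nbhs_infty_ge.
have [_ _ _ h] := he n rn; rewrite /= -h; congr partial_trace.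
apply/funext => t; rewrite big_map; apply: eq_bigr => j _.
by rewrite -star_blockE.
Unshelve. all: by end_near. Qed.
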